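(* Set $$C_1=\frac{2d}{d-1}\,\frac{1}{\langle\chi^2,\chi\rangle}.$$ For every $x\ge h^*$, as $n\to\infty$, $$P_x[N_n^+\neq\emptyset]=C_1\,\chi(x)\,n^{-1}(1+o(1)),$$ and $$P[N_n^+\neq\emptyset]=C_1\,\langle 1,\chi\rangle\,n^{-1}(1+o(1)).$$ If the event $\{N_n^+\neq\emptyset\}$ is replaced by $\{N_n\neq\emptyset\}$, the same results hold with $C_1$ replaced by $\widetilde C_1=C_1(d+1)/d$; that is, for every $x\ge h^*$, $P_x[N_n\neq\emptyset]=\widetilde C_1\chi(x)n^{-1}(1+o(1))$ and $P[N_n\neq\emptyset]=\widetilde C_1\langle 1,\chi\rangle n^{-1}(1+o(1))$.
   Context: Fix an integer $d\ge2$. $\mathbb T$ is the infinite $(d+1)$-regular tree with root $o$ and graph distance $d_{\mathbb T}$; $|v|=d_{\mathbb T}(o,v)$, and $p(v)$ is the parent of $v\ne o$ (the neighbour of $v$ on the geodesic to $o$). Fix a neighbour $\bar o$ of $o$; the forward tree is $\mathbb T^+=\{v\in\mathbb T:\bar o\text{ is not on the geodesic from }o\text{ to }v\}$ (every vertex of $\mathbb T^+$ has $d$ children in $\mathbb T^+$). Gaussian free field: let $\sigma_\nu^2=\frac{d}{d-1}$, $\sigma_Y^2=\frac{d+1}{d}$, and let $(Y_v)_{v\in\mathbb T}$ be independent centred Gaussians, $Y_o\sim\mathcal N(0,\sigma_\nu^2)$, $Y_v\sim\mathcal N(0,\sigma_Y^2)$ for $v\neq o$. Set $\varphi_o=Y_o$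 and recursively $\varphi_v=d^{-1}\varphi_{p(v)}+Y_v$ for $v\ne o$. $P$ is the law of $\varphi=(\varphi_v)_{v\in\mathbb T}$, and $P_x$ is the law of $\varphi$ conditioned on $\varphi_o=x$, i.e. the law obtained by the same recursion started with $\varphi_o=x$. For $h\in\mathbb R$, $\mathcal C_o^h$ is the connected component containing $o$ of $\{v\in\mathbb T:\varphi_v\ge h\}$ (empty if $\varphi_o<h$). The critical level is $h^*=\inf\{h\in\mathbb R:P[|\mathcal C_o^h|=\infty]=0\}$, known to satisfy $0<h^*<\infty$. Write $\mathcal C_o=\mathcal C_o^{h^*}$, $N_n=\{v\in\mathcal C_o:|v|=n\}$ and $N_n^+=N_n\cap\mathbb T^+$. Let $\nu=\mathcal N(0,\sigma_\nu^2)$, let $\langle\cdot,\cdot\rangle$ be the scalar product of $L^2(\nu)$, and let $\rho_Y$ be the density of $\mathcal N(0,\sigma_Y^2)$. For $h\in\mathbb R$ let $L_h[f](x)=1_{[h,\infty)}(x)\,d\int_{[h,\infty)}f(y)\rho_Y(y-x/d)\,dy$, a self-adjoint non-negative Hilbert–Schmidt operator on $L^2(\nu)$ with largest eigenvalue $\lambda_h$. It is known that $h^*$ is the unique $h$ with $\lambda_h=1$, that this eigenvalue is simple, and that there is a unique $\chi\ge0$ with unit $L^2(\nu)$-norm such that $L_{h^*}[\chi]=\chi$, with $\chi$ continuous and strictly positive on $[h^*,\infty)$ and vanishing on $(-\infty,h^* )$. *)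

(* Defs.v *)
From HB Require Import structures.
From mathcomp Require Import all_boot all_order all_algebra.
From mathcomp Require Import all_classical all_reals all_analysis.

Set Implicit Arguments.
Unset Strict Implicit.
Unset Printing Implicit Defensive.

Import Order.TTheory GRing.Theory Num.Theory.
Import numFieldNormedType.Exports.

Local Open Scope classical_set_scope.
Local Open Scope ring_scope.

(* The vertices of the (d+1)-regular tree are words: [None] is o; in
   [Some (i, w)], i is the branch at o (one of d+1) and w lists the later
   choices (one of d each), the most recent one first. *)
Definition vertex (d : nat) : Type := option ('I_d.+1 * seq 'I_d).

Definition origin {d : nat} : vertex d := None.

(* junk value: [parent origin = origin] *)
Definition parent {d : nat} (v : vertex d) : vertex d :=
  match v with
  | Some (i, _ :: w) => Some (i, w)
  | _ => None
  end.

Definition adj {d : nat} (u v : vertex d) : bool :=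
  ((v != origin) && (parent v == u)) || ((u != origin) && (parent u == v)).

Definition depth {d : nat} (v : vertex d) : nat :=
  if v is Some (_, w) then (size w).+1 else 0%N.

Lemma depth_parent (d : nat) (v : vertex d) : depth (parent v) = (depth v).-1.
Proof. by case: v => [[i [|a w]]|]. Qed.

(* The geodesic between [v] and o, listed from [v] to o. *)
Definition geodesic {d : nat} (v : vertex d) : seq (vertex d) :=
  traject parent v (depth v).+1.

Definition is_path {d : nat} (u v : vertex d) (p : seq (vertex d)) : Prop :=
  path adj u p /\ last u p = v.

Lemma geodesic_path (d : nat) (v : vertex d) :
  is_path v origin (behead (geodesic v)).
Proof.
rewrite /is_path /geodesic /=; move: {2 3 4}(depth v) (erefl (depth v)) => n.
elim: n v => [|n IHn] v vn; first by case: v vn => [[]|].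
have [|pp lp] := IHn (parent v); first by rewrite depth_parent vn.
split; rewrite //= pp andbT /adj eqxx andbT.
by apply/orP; right; case: v vn {IHn pp lp}.
Qed.

(* With [geodesic_path], [depth v] is the graph distance from o to [v]. *)
Lemma depth_le_path (d : nat) (v : vertex d) (p : seq (vertex d)) :
  is_path origin v p -> (depth v <= size p)%N.
Proof.
elim/last_ind: p v => [|p u IHp] v [].
  by move=> _ <-.
rewrite rcons_path last_rcons size_rcons => /andP[pp pu] <-.
have := IHp _ (conj pp erefl); case/orP: pu => /andP[_ /eqP].
  by move=> <-; rewrite depth_parent; case: (depth u).
by move=> <-; rewrite depth_parent => h;
  rewrite ltnW// ltnS (leq_trans (leq_pred _)).
Qed.

Definition forward_tree {d : nat} (obar : vertex d) : set (vertex d) :=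
  [set v | obar \notin geodesic v].

Section gff.
Context {R : realType} {d : nat}.

Definition sigma_nu : R := Num.sqrt (d%:R / (d%:R - 1)).
Definition sigma_Y : R := Num.sqrt ((d%:R + 1) / d%:R).

(* The field started from the value [x] at o and driven by the innovations
   [y v], v <> o; the value [y origin] is not used. *)
Fixpoint gff_branch (x : R) (y : vertex d -> R)
    (i : 'I_d.+1) (w : seq 'I_d) : R :=
  d%:R^-1 * (if w is _ :: w' then gff_branch x y i w' else x) + y (Some (i, w)).

Definition gff (x : R) (y : vertex d -> R) (v : vertex d) : R :=
  if v is Some (i, w) then gff_branch x y i w else x.

Lemma gff_origin (x : R) (y : vertex d -> R) : gff x y origin = x.
Proof. by []. Qed.

Lemma gffE (x : R) (y : vertex d -> R) (v : vertex d) : v != origin ->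
  gff x y v = d%:R^-1 * gff x y (parent v) + y v.
Proof. by case: v => [[i [|a w]]|]. Qed.

(* The component of o in the subgraph induced by [phi >= h]. *)
Definition cluster (h : R) (phi : vertex d -> R) : set (vertex d) :=
  [set v | exists2 p, is_path origin v p &
    all (fun u => h <= phi u) (origin :: p)].

Definition generation (h : R) (phi : vertex d -> R) (n : nat) :
    set (vertex d) :=
  cluster h phi `&` [set v | depth v = n].

Definition nu : probability (measurableTypeR R) R := normal_prob 0 sigma_nu.
Definition rho_Y : R -> R := normal_pdf 0 sigma_Y.

Definition inner_nu (f g : R -> R) : R := \int[nu]_x (f x * g x).

Definition L_op (h : R) (f : R -> R) (x : R) : R :=
  \1_(`[h, +oo[%classic) x *
  (d%:R * \int[lebesgue_measure]_(y in `[h, +oo[) (f y * rho_Y (y - x / d%:R))).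

(* The equation L_h chi = chi is an identity in L^2(nu); continuity on
   [h, +oo) and vanishing on (-oo, h) single out the representative. *)
Record normalized_eigenfunction (h : R) (chi : R -> R) : Prop := {
  chi_measurable : measurable_fun setT chi ;
  chi_ge0 : forall x, 0 <= chi x ;
  chi_norm1 : ('N[nu]_2%:E[EFin \o chi] = 1)%E ;
  chi_eigen : {ae nu, forall x, L_op h chi x = chi x} ;
  chi_continuous : {within `[h, +oo[, continuous chi} ;
  chi_gt0 : forall x, h <= x -> 0 < chi x ;
  chi_eq0 : forall x, x < h -> chi x = 0 }.

Definition C1 (chi : R -> R) : R :=
  2 * d%:R / (d%:R - 1) * (inner_nu (fun x => chi x ^+ 2) chi)^-1.

Definition C1_tilde (chi : R -> R) : R := C1 chi * (d%:R + 1) / d%:R.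

Context {dsp : measure_display} {Omega : measurableType dsp}.
Variable P : probability Omega R.

Definition mutually_independent (Y : vertex d -> {RV P >-> R}) : Prop :=
  forall (s : seq (vertex d)) (B : vertex d -> set R),
    uniq s -> (forall v, measurable (B v)) ->
    P [set w | forall v, v \in s -> B v (Y v w)] =
    (\prod_(v <- s) P (Y v @^-1` B v))%E.

Record gff_innovations (Y : vertex d -> {RV P >-> R}) : Prop := {
  innov_independent : mutually_independent Y ;
  innov_origin : forall A : set R, measurable A ->
    distribution P (Y origin) A = normal_prob 0 sigma_nu A ;
  innov_other : forall v, v != origin -> forall A : set R, measurable A ->
    distribution P (Y v) A = normal_prob 0 sigma_Y A }.

Variable Y : vertex d -> {RV P >-> R}.

(* [phi_from x] has law P_x, and [phi] has law P. *)
Definition phi_from (x : R) (w : Omega) : vertex d -> R :=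
  gff x (fun v => Y v w).
Definition phi (w : Omega) : vertex d -> R := phi_from (Y origin w) w.

Definition h_star : R :=
  inf [set h | P [set w | infinite_set (cluster h (phi w))] = 0%E].

(* Probabilities that N_n, resp. N_n^+, is nonempty, as real numbers. *)
Definition P_survive (n : nat) : R :=
  fine (P [set w | generation h_star (phi w) n !=set0]).

Definition P_survive_fwd (obar : vertex d) (n : nat) : R :=
  fine (P [set w | generation h_star (phi w) n `&` forward_tree obar !=set0]).

Definition Px_survive (x : R) (n : nat) : R :=
  fine (P [set w | generation h_star (phi_from x w) n !=set0]).

Definition Px_survive_fwd (obar : vertex d) (x : R) (n : nat) : R :=
  fine (P [set w |
    generation h_star (phi_from x w) n `&` forward_tree obar !=set0]).

End gff.

Arguments sigma_nu R d : clear implicits.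
Arguments sigma_Y R d : clear implicits.
Arguments nu R d : clear implicits.
Arguments inner_nu {R} d f g.
Arguments L_op {R} d h f x.
Arguments normalized_eigenfunction {R} d h chi.
Arguments C1 {R} d chi.
Arguments C1_tilde {R} d chi.

(* a_n = c n^-1 (1 + o(1)) as n -> oo *)
Definition inv_asymptotics {R : realType} (a : nat -> R) (c : R) : Prop :=
  exists2 eps : nat -> R, eps @ \oo --> 0 &
    forall n, (0 < n)%N -> a n = c * n%:R^-1 * (1 + eps n).

(* Main.v *)
Require Import Defs.
From HB Require Import structures.
From mathcomp Require Import all_boot all_order all_algebra.
From mathcomp Require Import all_classical all_reals all_analysis.
From mathcomp Require Import measurable_realfun ring lra.

(** Let [q n x] be the probability, given the value [x >= h] at a vertex with [d]
    children, that its cluster reaches [n] generations down ([h] is the critical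
    level). The subtrees of the children are independent given the value at their
    parent, so [q (n+1) = psi (L (q n))] with [psi t = 1 - (1 - t/d)^d], where [L]
    is the operator of the statement. This operator fixes [chi], it is self-adjoint
    in [L^2(nu)] by reversibility of the autoregression, and
    [psi t = t - b t^2 + O(t^3)] with [b = (d-1)/(2d)]. The heuristics is that
    [q n] aligns with [chi], say [q n = a n * chi], and that pairing the recursion
    with [chi] gives [a (n+1) = a n - b <chi^2,chi> (a n)^2], whence
    [a n = 1 / (b <chi^2,chi> n)], and [1 / (b <chi^2,chi>)] is [C1].

    The heuristics is made rigorous as follows.
    - The eigenfunction is bounded below by a positive constant
      ([chi_lower_bound]) and above by a slowly growing Gaussian exponential
      [growth] ([chi_growth]).
    - Multiples [A/n * chi] of the eigenfunction are supersolutions of the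
      recursion ([survival_le_chi]), and corrected multiples
      [e/n * chi - B/n^2 * growth^2] are subsolutions ([survival_ge_chi]), since
      [growth^2] is a Lyapunov function of [L] ([Lop_drift]). So [q n] is of order
      [1/n].
    - The Lyapunov function and a local minorization of the kernel give, by Harris'
      argument, a contraction of [L] modulo [chi] in a weighted supremum norm
      ([Lop_contraction]). As [q (n+1)] and [L (q n)] differ by [O(1/n^2)], the
      distance of [q n] to the line of [chi] is [O(1/n^2)] ([survival_near_ray]).
    - With [a n] the inner product of [q n] and [chi] ([overlap]), the recursion for
      [a n] therefore holds up to [O(1/n^3)] ([overlap_recursion]), and [1 / a n] has
      increments [b <chi^2,chi> + O(1/n)] ([quadratic_recursion_cvg]).
    Each of the four claims follows because the probability at stake equals a
    multiple of [a n] up to [O(1/n^2)] ([cvg_of_overlap]): [q n x], its mean under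
    [nu], and the same quantities with [d + 1] children at the root.

    On the probability side, events about disjoint sets of vertices are independent
    ([info_indep]), and an innovation independent of the rest can be integrated last
    ([freezing]); this identifies the survival probabilities with the solutions of
    the recursion ([alive_prob], [origin_prob]). *)

Set Implicit Arguments.
Unset Strict Implicit.
Unset Printing Implicit Defensive.

Import Order.TTheory GRing.Theory Num.Theory.
Import numFieldNormedType.Exports.

Local Open Scope classical_set_scope.
Local Open Scope ring_scope.

(** * Gaussian integrals *)

Section gaussian_integrals.
Context {R : realType}.
Notation leb := (@lebesgue_measure R).

(** The constant depends on the quadratic coefficient only, so that the growth in
    the linear coefficient is explicit. *)
Lemma gaussian_integral (A : R) : 0 < A -> exists2 C : R, 0 < C &
  forall B c : R,
    (\int[leb]_y (expR (- A * y ^+ 2 + B * y + c))%:E)%E =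
    (C * expR (B ^+ 2 / (4 * A) + c))%:E.
Proof.
move=> A0; pose s : R := Num.sqrt ((2 * A)^-1).
have s0 : 0 < s by rewrite sqrtr_gt0 invr_gt0 mulr_gt0.
have s2 : s ^+ 2 = (2 * A)^-1 by rewrite sqr_sqrtr// invr_ge0 mulr_ge0// ltW.
have sN0 : s != 0 by rewrite gt_eqF.
exists (normal_peak s)^-1 => [|B c]; first by rewrite invr_gt0 normal_peak_gt0.
pose m := B / (2 * A).
pose k := (normal_peak s)^-1 * expR (B ^+ 2 / (4 * A) + c).
transitivity (\int[leb]_y (k%:E * (normal_pdf m s y)%:E))%E.
  apply: eq_integral => y _; rewrite -EFinM; congr EFin.
  rewrite normal_pdfE// /k mulrACA mulVf ?gt_eqF ?normal_peak_gt0// mul1r.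
  rewrite /normal_fun -expRD; congr expR.
  by rewrite s2 /m; field; rewrite gt_eqF.
rewrite integralZl//; last exact: integrable_normal_pdf.
by rewrite integral_normal_pdf mule1.
Qed.

Lemma measurable_gaussian (A B c : R) :
  measurable_fun setT (fun y : R => expR (- A * y ^+ 2 + B * y + c)).
Proof.
apply: measurableT_comp => //; apply: measurable_funD => //.
apply: measurable_funD; first exact: measurable_funM.
exact: measurable_funM.
Qed.

Lemma integrable_gaussian (A B c : R) : 0 < A ->
  leb.-integrable setT (EFin \o (fun y => expR (- A * y ^+ 2 + B * y + c))).
Proof.
move=> A0; apply/integrableP; split.
  by apply/measurable_EFinP; exact: measurable_gaussian.
have [C _ CE] := gaussian_integral A0.
under eq_integral do rewrite /= ger0_norm ?expR_ge0//.
by rewrite CE ltry.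
Qed.

End gaussian_integrals.

(** * The densities of the field *)

Section densities.
Context {R : realType} (d : nat).
Hypothesis hd : (2 <= d)%N.
Notation leb := (@lebesgue_measure R).
Notation D := (d%:R : R).

Definition lam : R := (d%:R - 1) / (2 * d%:R).
Definition muY : R := d%:R / (2 * (d%:R + 1)).
(** The reference scale for growth at infinity. The eigenfunction is [O(growth)],
    the Lyapunov function is [growth ^+ 2], and [growth ^+ 4] is integrable for
    both densities because [4 / 5 < 1]: this is what the factor 5 is for. *)
Definition growth (x : R) : R := expR (lam / 5 * x ^+ 2).
Definition rho_nu : R -> R := normal_pdf 0 (sigma_nu R d).

Lemma d_ge2 : 2 <= D. Proof. by rewrite ler_nat. Qed.

Lemma lam_gt0 : 0 < lam.
Proof. by have d2 := d_ge2; rewrite /lam divr_gt0//; lra. Qed.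

Lemma sigma_nu_neq0 : sigma_nu R d != 0.
Proof.
have d2 := d_ge2; rewrite gt_eqF// sqrtr_gt0 divr_gt0//; lra.
Qed.

Lemma sigma_Y_neq0 : sigma_Y R d != 0.
Proof.
have d2 := d_ge2; rewrite gt_eqF// sqrtr_gt0 divr_gt0//; lra.
Qed.

Definition peakY : R := normal_peak (sigma_Y R d).
Definition peak_nu : R := normal_peak (sigma_nu R d).

Lemma peakY_gt0 : 0 < peakY.
Proof. exact/normal_peak_gt0/sigma_Y_neq0. Qed.

Lemma peak_nu_gt0 : 0 < peak_nu.
Proof. exact/normal_peak_gt0/sigma_nu_neq0. Qed.

Lemma rho_YE (z : R) : @rho_Y R d z = peakY * expR (- muY * z ^+ 2).
Proof.
have d2 := d_ge2.
rewrite /rho_Y normal_pdfE ?sigma_Y_neq0// /normal_fun subr0; congr (_ * expR _).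
rewrite /sigma_Y sqr_sqrtr; last by rewrite divr_ge0; lra.
by rewrite /muY; field; rewrite !gt_eqF//; lra.
Qed.

Lemma rho_nuE (z : R) : rho_nu z = peak_nu * expR (- lam * z ^+ 2).
Proof.
have d2 := d_ge2.
rewrite /rho_nu normal_pdfE ?sigma_nu_neq0// /normal_fun subr0.
congr (_ * expR _).
rewrite /sigma_nu sqr_sqrtr; last by rewrite divr_ge0; lra.
by rewrite /lam; field; rewrite !gt_eqF//; lra.
Qed.

Lemma rho_Y_gt0 (z : R) : 0 < @rho_Y R d z.
Proof. by rewrite rho_YE mulr_gt0 ?peakY_gt0 ?expR_gt0. Qed.

Lemma rho_nu_gt0 (z : R) : 0 < rho_nu z.
Proof. by rewrite rho_nuE mulr_gt0 ?peak_nu_gt0 ?expR_gt0. Qed.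

Lemma measurable_rho_Y : measurable_fun setT (@rho_Y R d).
Proof. exact: measurable_normal_pdf. Qed.

Lemma measurable_rho_Y_shift (c : R) :
  measurable_fun setT (fun y : R => @rho_Y R d (y - c)).
Proof.
by apply: measurableT_comp; [exact: measurable_rho_Y|exact: measurable_funB].
Qed.

Lemma measurable_rho_nu : measurable_fun setT rho_nu.
Proof. exact: measurable_normal_pdf. Qed.

(** Detailed balance of the autoregression [y = x / d + Y] with respect to the
    stationary law: the source of the self-adjointness of the operator. *)
Lemma rho_reversible (x y : R) :
  rho_nu x * @rho_Y R d (y - x / D) = rho_nu y * @rho_Y R d (x - y / D).
Proof.
have d2 := d_ge2.
rewrite !rho_nuE !rho_YE mulrACA [RHS]mulrACA -!expRD; congr (_ * expR _).
by rewrite /lam /muY; field; rewrite !gt_eqF//; lra.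
Qed.

Lemma measurable_growth n : measurable_fun setT (fun x => growth x ^+ n).
Proof.
apply: measurable_funX; apply: measurableT_comp => //.
by apply: measurable_funM => //; exact: measurable_funX.
Qed.

Lemma growth_ge1 x : 1 <= growth x.
Proof.
rewrite -expR0 ler_expR mulr_ge0 ?sqr_ge0// divr_ge0//; exact/ltW/lam_gt0.
Qed.

Lemma growth_gt0 x : 0 < growth x. Proof. exact: expR_gt0. Qed.

Lemma growth_expr x n : growth x ^+ n = expR (n%:R * lam / 5 * x ^+ 2).
Proof.
by rewrite /growth -expRM_natl; congr expR; rewrite !mulrA.
Qed.

Lemma lamE : lam = muY * (1 - D^-1 ^+ 2).
Proof.
by have d2 := d_ge2; rewrite /lam /muY; field; rewrite !gt_eqF//; lra.
Qed.

Lemma muY_gt0 : 0 < muY.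
Proof. by have d2 := d_ge2; rewrite /muY divr_gt0//; lra. Qed.

Lemma invd_bounds : 0 < D^-1 <= 2^-1.
Proof.
have d2 := d_ge2; rewrite invr_gt0 lef_pV2 ?posrE; last by lra.
  by rewrite d2 andbT; lra.
by lra.
Qed.

Lemma integrable_growth_nu :
  leb.-integrable setT (EFin \o (fun y => growth y ^+ 4 * rho_nu y)).
Proof.
have l0 := lam_gt0.
rewrite (_ : (fun y => _) =
    (fun y => peak_nu * expR (- (lam / 5) * y ^+ 2 + 0 * y + 0))); last first.
  apply/funext => y; rewrite growth_expr rho_nuE mulrCA -expRD.
  by congr (_ * expR _); field.
apply: (@integrableZl _ _ _ leb setT measurableT peak_nu
    (EFin \o (fun y => expR (- (lam / 5) * y ^+ 2 + 0 * y + 0)))).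
by apply: integrable_gaussian; lra.
Qed.

Lemma growth_rho_Y (n : nat) (x y : R) :
  growth y ^+ n * @rho_Y R d (y - x / D) =
  peakY * expR (- (muY - n%:R * lam / 5) * y ^+ 2 + (2 * muY * D^-1 * x) * y
                + - (muY * D^-1 ^+ 2 * x ^+ 2)).
Proof.
rewrite growth_expr rho_YE mulrCA -expRD.
by congr (_ * expR _); ring.
Qed.

Lemma lam_le_muY : lam <= muY.
Proof. by rewrite lamE mulrBr mulr1 gerBl mulr_ge0 ?sqr_ge0// ltW// muY_gt0. Qed.

Lemma muY_gt_lam (n : nat) : (n <= 4)%N -> 0 < muY - n%:R * lam / 5.
Proof.
have m0 := muY_gt0; have l0 := lam_gt0 => n4.
have lm := lam_le_muY.
have {}n4 : n%:R <= 4 :> R by rewrite ler_nat.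
nra.
Qed.

Lemma integrable_growth_rho_Y (x : R) :
  leb.-integrable setT
    (EFin \o (fun y => growth y ^+ 4 * @rho_Y R d (y - x / D))).
Proof.
under [X in EFin \o X]eq_fun do rewrite growth_rho_Y.
apply: (@integrableZl _ _ _ leb setT measurableT peakY (EFin \o (fun y => expR
  (- (muY - 4%:R * lam / 5) * y ^+ 2 + (2 * muY * D^-1 * x) * y
                + - (muY * D^-1 ^+ 2 * x ^+ 2))))).
by apply: integrable_gaussian; exact: (@muY_gt_lam 4).
Qed.

End densities.

(** * Integration over a half-line and the averaging operator *)

Section weighted_integrals.
Context {R : realType} (d : nat) (h : R).
Hypothesis hd : (2 <= d)%N.
Notation leb := (@lebesgue_measure R).
Notation D := (d%:R : R).

Definition half_line : set R := `[h, +oo[%classic.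

Lemma half_lineP y : half_line y <-> h <= y.
Proof. by rewrite /half_line /= in_itv /= andbT. Qed.

Lemma measurable_half_line : measurable half_line.
Proof. exact: measurable_itv. Qed.
Hint Resolve measurable_half_line : core.

(** A class of functions closed under linear combinations on which all the
    integrals below converge. *)
Definition tame (f : R -> R) : Prop := measurable_fun setT f /\
  exists C : R, forall y, h <= y -> `|f y| <= C * growth d y ^+ 4.

Lemma tame_le (f g : R -> R) : measurable_fun setT f -> tame g ->
  (forall y, h <= y -> `|f y| <= g y) -> tame f.
Proof.
move=> mf [_ [C gC]] fg; split=> //; exists C => y hy.
exact: le_trans (fg y hy) (le_trans (ler_norm _) (gC y hy)).
Qed.

Lemma tame_growth_pow n : (n <= 4)%N -> tame (fun y => growth d y ^+ n).
Proof.
move=> n4; split; first exact: measurable_growth.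
exists 1 => y _; rewrite mul1r ger0_norm; last exact/exprn_ge0/ltW/growth_gt0.
by rewrite ler_weXn2l// growth_ge1.
Qed.

Lemma tame_cst c : tame (fun=> c).
Proof.
split; first exact: measurable_cst.
exists `|c| => y _; rewrite ler_peMr// exprn_ege1// growth_ge1//.
Qed.

Lemma tameD f g : tame f -> tame g -> tame (fun y => f y + g y).
Proof.
move=> [mf [C fC]] [mg [C' gC]]; split; first exact: measurable_funD.
exists (C + C') => y hy; rewrite mulrDl (le_trans (ler_normD _ _))// lerD//.
  exact: fC.
exact: gC.
Qed.

Lemma tameZ c f : tame f -> tame (fun y => c * f y).
Proof.
move=> [mf [C fC]]; split; first exact: measurable_funM.
by exists (`|c| * C) => y hy; rewrite normrM -mulrA ler_wpM2l// fC.
Qed.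

Lemma tameB f g : tame f -> tame g -> tame (fun y => f y - g y).
Proof.
move=> tf tg; have := tameD tf (tameZ (-1) tg).
by under [X in tame X -> _]eq_fun do rewrite mulN1r.
Qed.

Lemma tame_of_growth (f : R -> R) (n : nat) (C : R) : (n <= 4)%N ->
  measurable_fun setT f -> (forall y, h <= y -> `|f y| <= C * growth d y ^+ n) ->
  tame f.
Proof.
move=> n4 mf fC; apply: (tame_le mf (tameZ C (tame_growth_pow n4))).
exact: fC.
Qed.

Definition wint (w f : R -> R) : R := \int[leb]_(y in half_line) (f y * w y).

Lemma eq_wint w f g : (forall y, h <= y -> f y = g y) -> wint w f = wint w g.
Proof.
by move=> fg; apply: eq_Rintegral => y /set_mem/half_lineP hy; rewrite fg.
Qed.

Section admissible_weight.
Variable w : R -> R.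
Hypothesis mw : measurable_fun setT w.
Hypothesis w0 : forall y, 0 <= w y.
Hypothesis iw :
  leb.-integrable setT (EFin \o (fun y => growth d y ^+ 4 * w y)).

Lemma tame_integrable f : tame f ->
  leb.-integrable half_line (EFin \o (fun y => f y * w y)).
Proof.
move=> [mf [C fC]].
have iC : leb.-integrable half_line
    (EFin \o (fun y => C * (growth d y ^+ 4 * w y))).
  apply: (@integrableZl _ _ _ leb half_line measurable_half_line C
    (EFin \o (fun y => growth d y ^+ 4 * w y))).
  exact: (@integrableS _ _ _ _ setT).
apply: le_integrable iC => //.
- by apply/measurable_EFinP; apply: measurable_funTS; exact: measurable_funM.
- move=> y /half_lineP hy /=; rewrite lee_fin normrM (ger0_norm (w0 y)).
  rewrite (le_trans _ (ler_norm _))// mulrA ler_wpM2r//; exact: fC.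
Qed.

Lemma wintD f g : tame f -> tame g ->
  wint w (fun y => f y + g y) = wint w f + wint w g.
Proof.
move=> /tame_integrable tf /tame_integrable tg.
rewrite /wint -RintegralD//.
by apply: eq_Rintegral => y _; rewrite mulrDl.
Qed.

Lemma wintZ c f : tame f -> wint w (fun y => c * f y) = c * wint w f.
Proof.
move=> /tame_integrable tf.
rewrite /wint -RintegralZl//.
by apply: eq_Rintegral => y _; rewrite mulrA.
Qed.

Lemma wintB f g : tame f -> tame g ->
  wint w (fun y => f y - g y) = wint w f - wint w g.
Proof.
move=> /tame_integrable tf /tame_integrable tg.
rewrite /wint -RintegralB//.
by apply: eq_Rintegral => y _; rewrite mulrBl.
Qed.

Lemma wint_le f g : tame f -> tame g -> (forall y, h <= y -> f y <= g y) ->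
  wint w f <= wint w g.
Proof.
move=> /tame_integrable tf /tame_integrable tg fg.
apply: le_Rintegral => //.
by move=> y /half_lineP hy; rewrite ler_wpM2r// fg.
Qed.

Lemma wint_ge0 f : (forall y, h <= y -> 0 <= f y) -> 0 <= wint w f.
Proof.
by move=> f0; apply: Rintegral_ge0 => y /half_lineP hy; rewrite mulr_ge0// f0.
Qed.

Lemma wint_norm_le f g : tame f -> tame g ->
  (forall y, h <= y -> `|f y| <= g y) -> `|wint w f| <= wint w g.
Proof.
move=> tf tg fg; rewrite ler_norml; apply/andP; split.
  rewrite -mulN1r -wintZ//; apply: wint_le => //; first exact: tameZ.
  by move=> y /fg; rewrite mulN1r ler_norml => /andP[].
by apply: wint_le => // y /fg; rewrite ler_norml => /andP[].
Qed.

Lemma wint_EFin f : tame f ->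
  (\int[leb]_(y in half_line) (f y * w y)%:E)%E = (wint w f)%:E.
Proof.
move=> /tame_integrable tf; rewrite /wint /Rintegral fineK//.
by apply: integrable_fin_num => //; exact: tf.
Qed.

Lemma wint_gt0 f : tame f -> (forall y, h <= y -> 0 < f y * w y) ->
  0 < wint w f.
Proof.
move=> tf f0; have fw := tame_integrable tf.
have : 0 <= wint w f by apply: Rintegral_ge0 => y /half_lineP /f0 /ltW.
rewrite le_eqVlt => /predU1P[/esym fw0|//]; exfalso.
have : ae_eq leb half_line (EFin \o (fun y => f y * w y)) (cst 0%E).
  apply/ae_eq_integral_abs => //; first exact: (measurable_int leb fw).
  transitivity ((wint w f)%:E); last by rewrite fw0.
  rewrite -wint_EFin//; apply: eq_integral => y /set_mem/half_lineP hy /=.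
  by rewrite ger0_norm// ltW// f0.
move=> [N [mN N0 hN]].
have hsubN : half_line `<=` N.
  by move=> y hy; apply: hN => /= /(_ hy) [] /eqP; rewrite gt_eqF// f0//; exact/half_lineP.
have : (leb half_line <= leb N)%E by apply: le_measure => //; rewrite inE.
move=> l; have := eq_ind _ (fun z => (leb half_line <= z)%E) l _ N0.
by rewrite /half_line lebesgue_measure_itv/= ltry.
Qed.

End admissible_weight.

(** The operator [L_h] of the field, without its indicator: only its values on
    [[h, +oo)] are used. *)
Definition Lop (f : R -> R) (x : R) : R :=
  D * wint (fun y => @rho_Y R d (y - x / D)) f.
Definition nu_int (f : R -> R) : R := wint (rho_nu d) f.

Let mY x := @measurable_rho_Y_shift R d (x / D).
Let Y0 x y : 0 <= @rho_Y R d (y - x / D).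
Proof. exact/ltW/(rho_Y_gt0 hd). Qed.
Let iY x := @integrable_growth_rho_Y R d hd x.
Let mN := @measurable_rho_nu R d.
Let N0 y : 0 <= @rho_nu R d y.
Proof. exact/ltW/(rho_nu_gt0 hd). Qed.
Let iN := @integrable_growth_nu R d hd.

Lemma LopD f g x : tame f -> tame g ->
  Lop (fun y => f y + g y) x = Lop f x + Lop g x.
Proof. by move=> tf tg; rewrite /Lop (wintD _ _ (iY x))// mulrDr. Qed.

Lemma LopB f g x : tame f -> tame g ->
  Lop (fun y => f y - g y) x = Lop f x - Lop g x.
Proof. by move=> tf tg; rewrite /Lop (wintB _ _ (iY x))// mulrBr. Qed.

Lemma LopZ c f x : tame f -> Lop (fun y => c * f y) x = c * Lop f x.
Proof. by move=> tf; rewrite /Lop (wintZ _ _ (iY x))// mulrCA. Qed.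

Lemma Lop_le f g x : tame f -> tame g -> (forall y, h <= y -> f y <= g y) ->
  Lop f x <= Lop g x.
Proof. by move=> tf tg fg; rewrite ler_wpM2l// (wint_le _ _ (iY x)). Qed.

Lemma Lop_ge0 f x : (forall y, h <= y -> 0 <= f y) -> 0 <= Lop f x.
Proof. by move=> f0; rewrite mulr_ge0// wint_ge0. Qed.

Lemma eq_nu_int f g : (forall y, h <= y -> f y = g y) -> nu_int f = nu_int g.
Proof. exact: eq_wint. Qed.

Lemma nu_intB f g : tame f -> tame g ->
  nu_int (fun y => f y - g y) = nu_int f - nu_int g.
Proof. by move=> tf tg; rewrite /nu_int (wintB _ _ iN). Qed.

Lemma nu_intZ c f : tame f -> nu_int (fun y => c * f y) = c * nu_int f.
Proof. by move=> tf; rewrite /nu_int (wintZ _ _ iN). Qed.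

Lemma nu_int_le f g : tame f -> tame g -> (forall y, h <= y -> f y <= g y) ->
  nu_int f <= nu_int g.
Proof. by move=> tf tg fg; exact: (wint_le mN N0 iN tf tg fg). Qed.

Lemma nu_int_ge0 f : (forall y, h <= y -> 0 <= f y) -> 0 <= nu_int f.
Proof. by move=> f0; exact: wint_ge0. Qed.

Lemma nu_int_norm_le f g : tame f -> tame g ->
  (forall y, h <= y -> `|f y| <= g y) -> `|nu_int f| <= nu_int g.
Proof. by move=> tf tg fg; exact: (wint_norm_le mN N0 iN tf tg fg). Qed.

Lemma nu_int_gt0 f : tame f -> (forall y, h <= y -> 0 < f y) -> 0 < nu_int f.
Proof.
move=> tf f0; apply: (wint_gt0 mN N0 iN tf) => y hy.
by rewrite mulr_gt0 ?f0// rho_nu_gt0.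
Qed.

Lemma Lop_EFin f x : tame f ->
  (D%:E * \int[leb]_(y in half_line) (f y * @rho_Y R d (y - x / D))%:E)%E =
  (Lop f x)%:E.
Proof. by move=> tf; rewrite (wint_EFin _ _ (iY x)). Qed.

(** Averaging over one generation divides the argument by [d], which turns the
    growth [growth ^+ 2] into at most [growth]. *)
Lemma Lop_growth : exists C : R, forall x,
  Lop (fun y => growth d y ^+ 2) x <= C * growth d x.
Proof.
have m0 := @muY_gt0 R d hd.
have A0 := @muY_gt_lam R d hd 2 isT.
have [C0 C00 CE] := gaussian_integral A0.
exists (D * (peakY d * C0)) => x.
have tw : tame (fun y => growth d y ^+ 2).
  exact: tame_growth_pow.
rewrite -lee_fin -(Lop_EFin x tw) -!mulrA [leRHS]EFinM lee_wpmul2l//.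
apply: (@le_trans _ _ (\int[leb]_y (growth d y ^+ 2 *
    @rho_Y R d (y - x / D))%:E)%E).
  apply: ge0_subset_integral => //.
    apply/measurable_EFinP; apply: measurable_funM; last exact: mY.
    exact: measurable_growth.
  by move=> y _; rewrite lee_fin mulr_ge0// ltW// exprn_gt0// growth_gt0.
under eq_integral do rewrite growth_rho_Y// EFinM.
rewrite integralZl//; last exact: integrable_gaussian.
rewrite CE -EFinM lee_fin ler_wpM2l ?(ltW (@peakY_gt0 R d hd))//.
rewrite ler_wpM2l ?(ltW C00)// ler_expR.
have /andP[i0 i2] := @invd_bounds R d hd.
set A := muY d - _ in A0 *; set e := D^-1 in i0 i2 *.
rewrite -subr_ge0.
have -> : lam d / 5 * x ^+ 2 -
   ((2 * muY d * e * x) ^+ 2 / (4 * A) + - (muY d * e ^+ 2 * x ^+ 2)) =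
  x ^+ 2 / A * (lam d / 5 * (A - 2 * muY d * e ^+ 2)).
  rewrite /A; field; rewrite gt_eqF//=; move: A0; rewrite /A; lra.
rewrite mulr_ge0 ?divr_ge0 ?sqr_ge0 ?(ltW A0)// mulr_ge0//.
  by rewrite divr_ge0// ltW// lam_gt0.
have e2 : 0 <= 3 / 5 - 8 / 5 * e ^+ 2 by nra.
have := mulr_ge0 (ltW m0) e2.
by rewrite /A (@lamE R d hd) -/e; lra.
Qed.

End weighted_integrals.

(** * Reversibility of the operator *)

Section kernel_symmetry.
Context {R : realType} (d : nat) (h : R).
Hypothesis hd : (2 <= d)%N.
Notation leb := (@lebesgue_measure R).
Notation D := (d%:R : R).
Notation ind := (\1_(half_line h) : R -> R).

Let ind_ge0 (k : R -> R) y : (forall y, h <= y -> 0 <= k y) -> 0 <= ind y * k y.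
Proof.
move=> k0; rewrite indicE; case: (boolP (y \in _)) => [/set_mem/half_lineP hy|_].
  by rewrite mul1r k0.
by rewrite mul0r.
Qed.

Let indic_integral (k : R -> \bar R) :
  (\int[leb]_(y in half_line h) k y = \int[leb]_y ((ind y)%:E * k y))%E.
Proof.
rewrite integral_mkcond; apply: eq_integral => y _.
rewrite patchE indicE; by case: ifPn => _; rewrite ?mul1e ?mul0e.
Qed.

Let F (f : R -> R) (z : R * R) : \bar R :=
  (ind z.2 * f z.2 * @rho_Y R d (z.2 - z.1 / D))%:E.

Let mind : measurable_fun setT ind.
Proof. apply: measurable_indic; exact: measurable_half_line. Qed.

Let mF f : measurable_fun setT f -> measurable_fun setT (F f).
Proof.
move=> mf; apply/measurable_EFinP.
have m2 (k : R -> R) : measurable_fun setT k ->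
    measurable_fun setT (fun z : R * R => k z.2).
  by move=> mk; exact: measurableT_comp.
apply: measurable_funM; first exact: (measurable_funM (m2 ind mind) (m2 f mf)).
apply: (measurableT_comp (measurable_rho_Y d)).
apply: measurable_funB; first exact: measurable_snd.
by apply: measurable_funM => //; exact: measurable_fst.
Qed.

Let F0 f z : (forall y, h <= y -> 0 <= f y) -> (0 <= F f z)%E.
Proof. by move=> f0; rewrite lee_fin mulr_ge0 ?ind_ge0// ltW// rho_Y_gt0. Qed.

Let Lop_F f x : tame d h f ->
  (Lop d h f x)%:E = (D%:E * \int[leb]_y F f (x, y))%E.
Proof.
move=> tf; rewrite -Lop_EFin// indic_integral; congr (_ * _)%E.
by apply: eq_integral => y _; rewrite -EFinM mulrA.
Qed.

Lemma measurable_Lop f : tame d h f -> (forall y, h <= y -> 0 <= f y) ->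
  measurable_fun setT (Lop d h f).
Proof.
move=> tf f0; have [mf _] := tf.
apply/measurable_EFinP.
rewrite (_ : EFin \o _ = (fun x => D%:E * fubini_F leb (F f) x)%E).
  apply: emeasurable_funM => //.
  by apply: measurable_fun_fubini_tonelli_F => //; [exact: mF|move=> z; exact: F0].
by apply/funext => x; rewrite /= Lop_F.
Qed.

(** Self-adjointness of the operator in L^2(nu): detailed balance and Tonelli. *)
Lemma nu_int_sym f g : tame d h f -> tame d h g ->
  (forall y, h <= y -> 0 <= f y) -> (forall y, h <= y -> 0 <= g y) ->
  nu_int d h (fun x => g x * Lop d h f x) =
  nu_int d h (fun x => f x * Lop d h g x).
Proof.
move=> tf tg f0 g0; have [mf _] := tf; have [mg _] := tg.
pose H (u v : R -> R) (z : R * R) : \bar R :=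
  ((ind z.1 * v z.1 * rho_nu d z.1)%:E * (D%:E * F u z))%E.
have mH u v : measurable_fun setT u -> measurable_fun setT v ->
    measurable_fun setT (H u v).
  move=> mu mv; apply: emeasurable_funM; last first.
    by apply: emeasurable_funM => //; exact: mF.
  apply/measurable_EFinP/measurable_funM.
    by apply: measurable_funM; exact: measurableT_comp.
  by apply: (measurableT_comp (measurable_rho_nu d)); exact: measurable_fst.
have H0 u v z : (forall y, h <= y -> 0 <= u y) ->
    (forall y, h <= y -> 0 <= v y) -> (0 <= H u v z)%E.
  move=> u0 v0; rewrite mule_ge0//.
    by rewrite lee_fin mulr_ge0 ?ind_ge0// ltW// rho_nu_gt0.
  by rewrite mule_ge0// ?F0// lee_fin.
have gen u v : tame d h u -> tame d h v ->
    (forall y, h <= y -> 0 <= u y) -> (forall y, h <= y -> 0 <= v y) ->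
  (\int[leb]_(x in half_line h) (v x * Lop d h u x * rho_nu d x)%:E)%E =
  (\int[leb]_x \int[leb]_y H u v (x, y))%E.
  move=> tu tv u0 v0; rewrite indic_integral; apply: eq_integral => x _.
  transitivity (\int[leb]_y ((ind x * v x * rho_nu d x)%:E *
    (D%:E * F u (x, y))))%E; last by [].
  rewrite ge0_integralZl//; last 3 first.
  - apply: emeasurable_funM => //.
    apply: measurableT_comp; first by apply: mF; case: tu.
    exact: measurable_pair1.
  - by move=> y _; rewrite mule_ge0// ?F0// lee_fin.
  - by rewrite lee_fin mulr_ge0 ?ind_ge0// ltW// rho_nu_gt0.
  rewrite ge0_integralZl//; last 2 first.
  - apply: measurableT_comp; first by apply: mF; case: tu.
    exact: measurable_pair1.
  - by move=> y _; exact: F0.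
  by rewrite -Lop_F// -!EFinM; congr EFin => /=; ring.
rewrite /nu_int /wint /Rintegral; congr fine.
rewrite (gen f g tf tg f0 g0) (gen g f tg tf g0 f0).
rewrite (@fubini_tonelli _ _ _ _ _ leb leb (H f g) (mH f g mf mg)
  (fun z => H0 f g z f0 g0)).
apply: eq_integral => x _; apply: eq_integral => y _.
rewrite /H /F /= -!EFinM; congr EFin.
have := @rho_reversible R d hd x y; set a := rho_Y _; set b := rho_Y _ => e.
transitivity (ind y * g y * D * (ind x * f x) * (rho_nu d y * b)); first by ring.
by rewrite -e; ring.
Qed.

End kernel_symmetry.

(** * A priori growth of the eigenfunction *)

Section normal_law.
Context {R : realType}.
Notation leb := (@lebesgue_measure R).

(** Uniqueness of the Radon-Nikodym derivative. *)
Lemma integral_normal_prob (m s : R) (f : R -> \bar R) :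
  measurable_fun setT f -> (forall x, 0 <= f x)%E ->
  (\int[normal_prob m s]_x f x = \int[leb]_x (f x * (normal_pdf m s x)%:E))%E.
Proof.
move=> mf f0; have dom := normal_prob_dominates m s.
rewrite -(Radon_Nikodym_SigmaFinite.change_of_variables dom)//.
have RNi := Radon_Nikodym_SigmaFinite.f_integrable dom.
have mpdf : measurable_fun setT (EFin \o normal_pdf m s).
  by apply/measurable_EFinP; exact: measurable_normal_pdf.
apply: ae_eq_integral => //.
- by apply: emeasurable_funM => //; exact: measurable_int RNi.
- exact: emeasurable_funM.
apply: ae_eqe_mul2l; apply: integral_ae_eq => //.
by move=> E _ mE; rewrite -Radon_Nikodym_SigmaFinite.f_integral.
Qed.

End normal_law.

Section eigenfunction.
Context {R : realType} (d : nat) (h : R) (chi : R -> R).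
Hypothesis hd : (2 <= d)%N.
Hypothesis hchi : normalized_eigenfunction d h chi.
Notation leb := (@lebesgue_measure R).
Notation D := (d%:R : R).

Let mchi := chi_measurable hchi.
Let chi0 := chi_ge0 hchi.

Let int_chi2_nu : (\int[nu R d]_x (chi x ^+ 2)%:E = 1)%E.
Proof.
have two0 : (2 : R) != 0 by [].
have := @poweR_Lnorm _ _ _ (nu R d) (EFin \o chi) 2 two0.
rewrite (chi_norm1 hchi) poweR1r => ->; apply: eq_integral => x _ /=.
by rewrite powR_mulrn// ger0_norm.
Qed.

Local Notation chi2_rho := (fun x => chi x ^+ 2 * rho_nu d x).

Let mchi2_rho : measurable_fun setT chi2_rho.
Proof.
by apply: measurable_funM; [exact: measurable_funX|exact: measurable_rho_nu].
Qed.

Let int_chi2_rho : (\int[leb]_x (chi2_rho x)%:E = 1)%E.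
Proof.
have mchi2 : measurable_fun setT (fun x => (chi x ^+ 2)%:E).
  by apply/measurable_EFinP; exact: measurable_funX.
rewrite -int_chi2_nu integral_normal_prob//.
by move=> x; rewrite lee_fin sqr_ge0.
Qed.

Lemma integrable_chi2_rho : leb.-integrable setT (EFin \o chi2_rho).
Proof.
apply/integrableP; split; first by apply/measurable_EFinP.
under eq_integral.
  move=> x _; rewrite /= ger0_norm; last first.
    by rewrite mulr_ge0 ?sqr_ge0// ltW// rho_nu_gt0.
  over.
by rewrite int_chi2_rho ltry.
Qed.

(** The normalization of the eigenfunction, as an integral over the half-line. *)
Lemma nu_int_chi2 : nu_int d h (fun x => chi x * chi x) = 1.
Proof.
rewrite /nu_int /wint Rintegral_mkcond -[RHS]/(fine 1%E) -int_chi2_rho.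
congr fine; apply: eq_integral => x _; congr EFin.
rewrite patchE; case: ifPn => [_|/negP xh]; first by rewrite expr2.
rewrite (chi_eq0 hchi) ?expr0n ?mul0r// ltNge; apply/negP => hx; apply: xh.
by rewrite inE; exact/half_lineP.
Qed.

Let sq_ratio (x y : R) : R := @rho_Y R d (y - x / D) ^+ 2 / rho_nu d y.

Let sq_ratioE x y : sq_ratio x y = peakY d ^+ 2 / peak_nu d *
  expR (- (2 * muY d - lam d) * y ^+ 2 + (4 * muY d * D^-1 * x) * y
        + - (2 * muY d * D^-1 ^+ 2 * x ^+ 2)).
Proof.
rewrite /sq_ratio rho_YE// rho_nuE// exprMn invfM mulrACA; congr (_ * _).
by rewrite -expRN -expRM_natl -expRD; congr expR; ring.
Qed.

Let A_gt0 : 0 < 2 * muY d - lam d :> R.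
Proof.
have m0 := @muY_gt0 R d hd; have lm := @lam_le_muY R d hd.
lra.
Qed.

Let integrable_sq_ratio x : leb.-integrable setT (EFin \o sq_ratio x).
Proof.
have -> : sq_ratio x = fun y => peakY d ^+ 2 / peak_nu d *
  expR (- (2 * muY d - lam d) * y ^+ 2 + (4 * muY d * D^-1 * x) * y
        + - (2 * muY d * D^-1 ^+ 2 * x ^+ 2)).
  by apply/funext => y; exact: sq_ratioE.
apply: (@integrableZl _ _ _ leb setT measurableT _ (EFin \o _)).
exact: integrable_gaussian.
Qed.

Let int_sq_ratio : exists2 C : R, 0 < C &
  forall x, (\int[leb]_y (sq_ratio x y)%:E <= (C * growth d x ^+ 2)%:E)%E.
Proof.
have [C0 C00 CE] := gaussian_integral A_gt0.
have p0 := @peakY_gt0 R d hd; have p1 := @peak_nu_gt0 R d hd.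
exists (peakY d ^+ 2 / peak_nu d * C0) => [|x].
  by rewrite mulr_gt0// divr_gt0// exprn_gt0.
under eq_integral do rewrite sq_ratioE EFinM.
rewrite integralZl//; last exact: integrable_gaussian.
rewrite CE -EFinM lee_fin -[leRHS]mulrA.
rewrite ler_wpM2l; [by []|by rewrite divr_ge0 ?exprn_ge0 ?ltW|].
rewrite ler_wpM2l ?(ltW C00)// growth_expr ler_expR.
have /andP[i0 i2] := @invd_bounds R d hd.
have m0 := @muY_gt0 R d hd.
have l0 := @lam_gt0 R d hd.
have A0 := A_gt0; set A := 2 * muY d - _ in A0 *; set e := D^-1 in i0 i2 *.
rewrite -subr_ge0.
have -> : 2%:R * lam d / 5 * x ^+ 2 -
   ((4 * muY d * e * x) ^+ 2 / (4 * A) + - (2 * muY d * e ^+ 2 * x ^+ 2)) =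
  x ^+ 2 / A * (2 * lam d * (A / 5 - muY d * e ^+ 2)).
  rewrite /A; field; rewrite gt_eqF//=; move: A0; rewrite /A; lra.
rewrite mulr_ge0 ?divr_ge0 ?sqr_ge0 ?(ltW A0)// mulr_ge0//; first by lra.
have e2 : 0 <= 1 / 5 - 4 / 5 * e ^+ 2 by nra.
have := mulr_ge0 (ltW m0) e2.
by rewrite /A (@lamE R d hd) -/e; lra.
Qed.

(* Cauchy-Schwarz in the form of a weighted arithmetic-geometric inequality; the
   weight [t] is optimized later. *)
Let amgm t x y : 0 < t -> chi y * @rho_Y R d (y - x / D) <=
  t / 2 * chi2_rho y + (2 * t)^-1 * sq_ratio x y.
Proof.
move=> t0; have r0 := @rho_nu_gt0 R d hd y; have s0 := rho_Y_gt0 hd (y - x / D).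
rewrite /sq_ratio; set r := rho_nu d y in r0 *.
set s := rho_Y _ in s0 *; set c := chi y.
rewrite -subr_ge0.
have -> : t / 2 * (c ^+ 2 * r) + (2 * t)^-1 * (s ^+ 2 / r) - c * s =
   (t * c * r - s) ^+ 2 / (2 * t * r).
  by field; rewrite !gt_eqF.
by rewrite divr_ge0 ?sqr_ge0// !mulr_ge0// ltW.
Qed.

Let integrable_split t x : leb.-integrable setT
  (EFin \o (fun y => t / 2 * chi2_rho y + (2 * t)^-1 * sq_ratio x y)).
Proof.
apply: (@integrableD _ _ _ leb setT measurableT
  (EFin \o (fun y => t / 2 * chi2_rho y))
  (EFin \o (fun y => (2 * t)^-1 * sq_ratio x y))).
  exact: (@integrableZl _ _ _ leb setT measurableT _ (EFin \o chi2_rho)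
    integrable_chi2_rho).
exact: (@integrableZl _ _ _ leb setT measurableT _ (EFin \o _)).
Qed.

Lemma integrable_chi_rho_Y x : leb.-integrable (half_line h)
  (EFin \o (fun y => chi y * @rho_Y R d (y - x / D))).
Proof.
apply: (@integrableS _ _ _ _ setT) => //; first exact: measurable_half_line.
apply: le_integrable (integrable_split 1 x) => //.
  apply/measurable_EFinP/measurable_funM; first exact: mchi.
  exact: measurable_rho_Y_shift.
move=> y _; rewrite /= lee_fin ger0_norm; last first.
  by rewrite mulr_ge0// ltW// rho_Y_gt0.
exact: le_trans (amgm x y ltr01) (ler_norm _).
Qed.

(** [chi] lies in [L^2(nu)], and [rho_Y (y - x / d)] has a density with
    respect to [nu] whose [L^2(nu)] norm is at most of order [growth x]. *)
Lemma chi_Lop_growth : exists C, forall x, Lop d h chi x <= C * growth d x.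
Proof.
have [C C0 hC] := int_sq_ratio.
exists (D * (2^-1 + C / 2)) => x; rewrite -mulrA ler_wpM2l//.
have g0 := growth_gt0 d x; set t := growth d x in g0 *.

have mh := measurable_half_line h.
have sub f : leb.-integrable setT (EFin \o f) ->
    leb.-integrable (half_line h) (EFin \o f).
  by move=> i; exact: (@integrableS _ _ _ _ setT).
apply: (@le_trans _ _
  (\int[leb]_(y in half_line h) (t / 2 * chi2_rho y + (2 * t)^-1 * sq_ratio x y))).
  apply: le_Rintegral => //.
  - exact: integrable_chi_rho_Y.
  - exact/sub/integrable_split.
  - by move=> y _; exact: amgm.
have zl c f : leb.-integrable setT (EFin \o f) ->
    leb.-integrable (half_line h) (EFin \o (fun y => c * f y)).
  by move=> i; apply: (@integrableZl _ _ _ leb _ mh _ (EFin \o _)); exact: sub.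
have i1 := integrable_chi2_rho; have i2 := integrable_sq_ratio x.
rewrite RintegralD//; [|exact: (zl _ chi2_rho i1)|exact: (zl _ _ i2)].
rewrite !RintegralZl//; [|exact: (sub _ i2)|exact: (sub chi2_rho i1)].
have -> : \int[leb]_(y in half_line h) chi2_rho y = 1.
  by rewrite -nu_int_chi2; apply: eq_Rintegral => y _; rewrite expr2.
have -> : (2^-1 + C / 2) * t = t / 2 * 1 + C / 2 * t by field.
rewrite lerD2l.
apply: (@le_trans _ _ ((2 * t)^-1 * (C * t ^+ 2))); last first.
  by rewrite le_eqVlt; apply/orP; left; apply/eqP; field; rewrite gt_eqF.
rewrite ler_wpM2l; [by []|by rewrite invr_ge0 mulr_ge0// ltW|].
rewrite -lee_fin /Rintegral fineK; last first.
  by apply: integrable_fin_num => //; exact: sub.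
apply: le_trans (hC x); apply: ge0_subset_integral => //.
  by have /integrableP[] := integrable_sq_ratio x.
move=> y _; rewrite lee_fin divr_ge0 ?sqr_ge0//.
by rewrite ltW// rho_nu_gt0.
Qed.

End eigenfunction.

(** * The eigenvalue equation at every point *)

Section eigen_equation.
Context {R : realType} (d : nat) (h : R) (chi : R -> R).
Hypothesis hd : (2 <= d)%N.
Hypothesis hchi : normalized_eigenfunction d h chi.
Notation leb := (@lebesgue_measure R).
Notation D := (d%:R : R).

Let mchi := chi_measurable hchi.
Let chi0 := chi_ge0 hchi.

Let integrable_chi_rho_nu :
  leb.-integrable (half_line h) (EFin \o (fun y => chi y * rho_nu d y)).
Proof.
apply: (@integrableS _ _ _ _ setT) => //; first exact: measurable_half_line.
have ig : leb.-integrable setT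
    (EFin \o (fun y => rho_nu d y + chi y ^+ 2 * rho_nu d y)).
  apply: (@integrableD _ _ _ leb setT measurableT (EFin \o rho_nu d)
    (EFin \o (fun y => chi y ^+ 2 * rho_nu d y))).
    exact: integrable_normal_pdf.
  exact: integrable_chi2_rho hchi.
apply: le_integrable ig => //.
  apply/measurable_EFinP/measurable_funM; first exact: mchi.
  exact: measurable_rho_nu.
move=> y _; have r0 := @rho_nu_gt0 R d hd y; have c0 := chi0 y.
rewrite /= lee_fin !ger0_norm ?addr_ge0 ?mulr_ge0 ?sqr_ge0 ?(ltW r0)//.
by rewrite -{2}[rho_nu d y]mul1r -mulrDl ler_wpM2r ?(ltW r0)//; nra.
Qed.

Lemma continuous_Lop_chi : continuous (Lop d h chi).
Proof.
move=> x0; apply: cvgM; first exact: cvg_cst.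
pose u := x0 - 1; pose v := x0 + 1; pose M := `|u| + `|v|.
pose C := peakY d / peak_nu d * expR (lam d * M ^+ 2).
have C0 : 0 <= C.
  by rewrite mulr_ge0 ?expR_ge0// divr_ge0// ltW ?peakY_gt0 ?peak_nu_gt0.
have := @continuity_under_integral R _ _ leb
  (fun x y => chi y * @rho_Y R d (y - x / D)) _ (measurable_half_line h) u v
  _ _ (fun y => C * (chi y * rho_nu d y)).
move=> /(_ (fun x _ => integrable_chi_rho_Y hd hchi x)); apply.
- apply: aeW => y _ x _; apply: cvgM; first exact: cvg_cst.
  apply: (cvg_comp (fun x => y - x / D) (@rho_Y R d)); last first.
    exact/continuous_normal_pdf/sigma_Y_neq0.
  by apply: cvgB; [exact: cvg_cst|apply: cvgM; [exact: cvg_id|exact: cvg_cst]].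
- apply: (@integrableZl _ _ _ leb _ (measurable_half_line h) _ (EFin \o _)).
  exact: integrable_chi_rho_nu.
- move=> x /=; rewrite in_itv/= => /andP[ux xv]; apply: aeW => y _.
  have r0 := @rho_nu_gt0 R d hd y; have rx := @rho_nu_gt0 R d hd x.
  rewrite ger0_norm; last by rewrite mulr_ge0// ltW// rho_Y_gt0.
  rewrite mulrCA ler_wpM2l// -(ler_pM2l rx) rho_reversible//.
  have -> : rho_nu d x * (C * rho_nu d y) = rho_nu d y * (rho_nu d x * C) by ring.
  rewrite ler_wpM2l ?(ltW r0)// (@le_trans _ _ (peakY d))//.
    exact/normal_pdf_ub/sigma_Y_neq0.
  have p0 := @peak_nu_gt0 R d hd; have py := @peakY_gt0 R d hd.
  rewrite /C rho_nuE//; set e1 := expR _; set e2 := expR _.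
  have -> : peak_nu d * e1 * (peakY d / peak_nu d * e2) = peakY d * (e1 * e2).
    by field; rewrite gt_eqF.
  rewrite -expRD.
  rewrite ler_peMr ?(ltW py)// -expR0 ler_expR.
  have l0 := @lam_gt0 R d hd.
  have xM : `|x| <= M.
    rewrite /M ler_norml; have := ler_norm (- u); have := ler_norm v.
    by have := normr_ge0 u; have := normr_ge0 v; rewrite normrN; lra.
  have : x ^+ 2 <= M ^+ 2.
    by rewrite -[x ^+ 2]real_normK ?num_real// lerXn2r ?nnegrE// addr_ge0.
  by move=> /(ler_wpM2l (ltW l0)); lra.
- by rewrite inE /= in_itv/= /u /v; lra.
Qed.

(** Both sides are continuous from the right, and a right neighbourhood of a point
    is not negligible. *)
Lemma Lop_chi x : h <= x -> Lop d h chi x = chi x.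
Proof.
move=> hx; apply: contrapT => ne.
have cvg1 : (fun x => Lop d h chi x - chi x) y @[y --> x^'+] -->
    Lop d h chi x - chi x.
  apply: cvgB.
    by apply: cvg_at_right_filter; exact: continuous_Lop_chi.
  have /continuous_within_itvcyP[ci ch] := chi_continuous hchi.
  move: hx; rewrite le_eqVlt => /predU1P[<-//|hx].
  by apply: cvg_at_right_filter; apply: ci; rewrite in_itv/= hx.
have ne0 : Lop d h chi x - chi x != 0 by rewrite subr_eq0; exact/eqP.
have : \forall y \near x^'+, Lop d h chi y - chi y != 0.
  exact: cvgr_neq0 cvg1 ne0.
rewrite /at_right near_withinE near_simpl => /nbhs_ballP[e /= e0 xe].
pose A := `]x, (x + e)[%classic : set R.
have mA : measurable A by exact: measurable_itv.
have neA y : A y -> L_op d h chi y <> chi y.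
  rewrite /A /= in_itv/= => /andP[xy ye].
  have hy : h <= y by rewrite (le_trans hx)// ltW.
  have := xe y; rewrite /ball/= ltr_distlC subr_eq0 => /(_ _ xy) ne'.
  rewrite /L_op indicE mem_set ?mul1r; last exact/half_lineP.
  apply/eqP; apply: ne'; lra.
have A0 : nu R d A = 0%E.
  apply/negligibleP => //; apply: negligibleS (chi_eigen hchi).
  by move=> y Ay /=; exact: neA.
have : ae_eq leb A (EFin \o rho_nu d) (cst 0%E).
  apply/ae_eq_integral_abs => //.
    by apply/measurable_EFinP; apply: measurable_funTS; exact: measurable_rho_nu.
  rewrite -[RHS]A0; apply: eq_integral => y _ /=.
  by rewrite ger0_norm// ltW// rho_nu_gt0.
move=> [N [mN N0 AN]].
have AsubN : A `<=` N.
  move=> y Ay; apply: AN => /= /(_ Ay) [] /eqP.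
  by rewrite gt_eqF// rho_nu_gt0.
have lAN : (leb A <= leb N)%E by apply: le_measure => //; rewrite inE.
have : (leb A <= 0)%E := eq_ind _ (fun z => (leb A <= z)%E) lAN _ N0.
rewrite lebesgue_measure_itv/= lte_fin ltrDl e0.
by rewrite -EFinD lee_fin addrAC subrr add0r leNgt e0.
Qed.

Lemma chi_growth : exists2 C, 0 < C & forall x, h <= x -> chi x <= C * growth d x.
Proof.
have [C hC] := chi_Lop_growth hd hchi.
have C0 : 0 < C.
  have := hC h; rewrite Lop_chi// => /(lt_le_trans (chi_gt0 hchi (lexx h))).
  by rewrite pmulr_lgt0// growth_gt0.
by exists C => // x hx; rewrite -Lop_chi.
Qed.

End eigen_equation.

(** * The eigenfunction is bounded away from zero *)

Section window.
Context {R : realType} (d : nat).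
Hypothesis hd : (2 <= d)%N.
Notation leb := (@lebesgue_measure R).

(** The mass outside the window is compared with a wider Gaussian. *)
Lemma half_mass_window : exists2 M : R, 0 < M & forall m : R,
  2^-1 <= \int[leb]_(y in `[m - M, m + M]) @rho_Y R d (y - m).
Proof.
have aux (a b : R) : 1 <= a + b -> b <= 2^-1 -> 2^-1 <= a by lra.
have m0 := @muY_gt0 R d hd; have p0 := @peakY_gt0 R d hd.
have a0 : 0 < muY d / 2 :> R by rewrite divr_gt0.
have [C C0 CE] := gaussian_integral a0.
pose M : R := 1 + 2 * peakY d * C / (muY d / 2).
have M1 : 1 <= M.
  by rewrite lerDl; apply: divr_ge0; rewrite ?(ltW a0)// !mulr_ge0// ltW.
have M0 : 0 < M by rewrite (lt_le_trans _ M1).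
exists M => // m; pose W := `[m - M, m + M]%classic : set R.
have mW : measurable W by exact: measurable_itv.
pose E := expR (- (muY d / 2) * M ^+ 2).
pose T (y : R) := expR (- (muY d / 2) * y ^+ 2 + muY d * m * y
  + - (muY d / 2 * m ^+ 2)).
have ET : E * peakY d * C <= 2^-1.
  rewrite -(ler_pM2l (expR_gt0 (muY d / 2 * M ^+ 2))).
  set e1 := expR _; have -> : e1 * (E * peakY d * C) = e1 * E * (peakY d * C) by ring.
  have -> : e1 * E = 1 by rewrite /e1 /E -expRD mulNr subrr expR0.
  rewrite mul1r /e1.
  have : 1 + muY d / 2 * M ^+ 2 <= expR (muY d / 2 * M ^+ 2) by exact: expR_ge1Dx.
  have : muY d / 2 * M <= muY d / 2 * M ^+ 2.
    by rewrite ler_wpM2l ?(ltW a0)// expr2 ler_peMr// ltW.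
  have : 2 * peakY d * C <= muY d / 2 * M.
    by rewrite /M mulrDr mulr1 [X in _ + X]mulrC divfK ?gt_eqF// lerDr ltW.
  lra.
have irho : leb.-integrable setT (EFin \o (fun y => @rho_Y R d (y - m))).
  rewrite (_ : (fun y => _) = normal_pdf m (sigma_Y R d)).
    exact: integrable_normal_pdf.
  apply/funext => y; rewrite /rho_Y !normal_pdfE ?sigma_Y_neq0//.
  by rewrite /normal_fun subr0.
have irhoW : leb.-integrable setT
    (EFin \o ((fun y => @rho_Y R d (y - m)) \_ W)).
  have : leb.-integrable W (EFin \o (fun y => @rho_Y R d (y - m))).
    by apply: (@integrableS _ _ _ _ setT).
  by move=> /(iffLR (@integrable_mkcond _ _ _ leb W _ mW)); rewrite restrict_EFin.
have iT : leb.-integrable setT (EFin \o (fun y => E * peakY d * T y)).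
  apply: (@integrableZl _ _ _ leb setT measurableT _ (EFin \o T)).
  exact: integrable_gaussian.
have i1 : \int[leb]_y @rho_Y R d (y - m) = 1.
  rewrite -[RHS]/(fine 1%E) -(integral_normal_pdf m (sigma_Y R d)).
  congr fine; apply: eq_integral => y _; congr EFin.
  rewrite /rho_Y !normal_pdfE ?sigma_Y_neq0//.
  by rewrite /normal_fun subr0.
have : \int[leb]_y @rho_Y R d (y - m) <=
    \int[leb]_y (((fun y => @rho_Y R d (y - m)) \_ W) y + E * peakY d * T y).
  apply: le_Rintegral => //.
    exact: (@integrableD _ _ _ leb setT measurableT (EFin \o _) (EFin \o _)).
  move=> y _; rewrite patchE; case: ifPn => [_|/negP yW].
    by rewrite lerDl !mulr_ge0 ?expR_ge0// ltW.
  rewrite add0r rho_YE// mulrAC -/E mulrC ler_wpM2r ?(ltW p0)//.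
  rewrite /E /T -expRD ler_expR.
  have : M ^+ 2 <= (y - m) ^+ 2.
    have : M <= `|y - m|.
      rewrite leNgt; apply/negP; rewrite ltr_distl => /andP[h1 h2].
      by apply: yW; rewrite inE /W /= in_itv/= !ltW.
    move=> h1; rewrite -[(y - m) ^+ 2]real_normK ?num_real//.
    by rewrite lerXn2r ?nnegrE// ltW.
  by move=> /(ler_wpM2l (ltW a0)); lra.
rewrite i1 RintegralD// RintegralZl//; last exact: integrable_gaussian.
have -> : \int[leb]_y T y = C * expR
    ((muY d * m) ^+ 2 / (4 * (muY d / 2)) + - (muY d / 2 * m ^+ 2)).
  by rewrite /Rintegral CE.
rewrite -Rintegral_mkcond.
have -> : (muY d * m) ^+ 2 / (4 * (muY d / 2)) - muY d / 2 * m ^+ 2 = 0.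
  by field; rewrite gt_eqF.
rewrite expR0 mulr1 => le1; exact: (aux _ _ le1 ET).
Qed.

End window.

Section eigenfunction_bounds.
Context {R : realType} (d : nat) (h : R) (chi : R -> R).
Hypothesis hd : (2 <= d)%N.
Hypothesis hchi : normalized_eigenfunction d h chi.
Notation leb := (@lebesgue_measure R).
Notation D := (d%:R : R).

Lemma tame_chi : tame d h chi.
Proof.
have [C C0 hC] := chi_growth hd hchi.
apply: (@tame_of_growth _ _ _ hd chi 1 C) => //; first exact: (chi_measurable hchi).
by move=> y hy; rewrite expr1 ger0_norm ?(chi_ge0 hchi)// hC.
Qed.

(** A lower bound on [[h, T]] propagates to [[h, T + 1]] for large [T]: the values
    [x / d + Y] fall in a window inside [[h, T]] with probability at least one
    half, and this is multiplied by [d >= 2]. *)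
Lemma chi_lower_bound : exists2 c, 0 < c & forall x, h <= x -> c <= chi x.
Proof.
have [M M0 hM] := @half_mass_window R d hd.
have d2 : 2 <= D by exact: d_ge2.
have i2 := @invd_bounds R d hd.
pose T0 : R := `|h| + D * (`|h| + M) + 1 + 2 * M.
have h0 := normr_ge0 h; have hn := ler_norm h.
have DM : 0 <= D * (`|h| + M) by rewrite mulr_ge0// addr_ge0// ltW.
have hT : h <= T0 by rewrite /T0; lra.
have [c cI cmin] : exists2 c, c \in `[h, T0] &
    forall t, t \in `[h, T0] -> chi c <= chi t.
  apply: EVT_min => //; apply: continuous_subspaceW (chi_continuous hchi).
  by apply: subset_itvl; rewrite bnd_simp.
have hc : h <= c by move: cI; rewrite in_itv/= => /andP[].
have c0 := chi_gt0 hchi hc.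
exists (chi c) => //.
suff step k x : h <= x -> x <= T0 + k%:R -> chi c <= chi x.
  move=> x hx; apply: (step (Num.truncn `|x|).+1) => //.
  have := truncnS_gt `|x|; have := ler_norm x; rewrite /T0; lra.
elim: k x => [|k IH] x hx xT.
  by apply: cmin; rewrite in_itv/= hx/=; rewrite addr0 in xT.
have [xTk|xTk] := leP x (T0 + k%:R); first exact: IH.
rewrite -(Lop_chi hd hchi hx).
have k0 : 0 <= k%:R :> R by [].
rewrite -[k.+1]addn1 natrD in xT.
have x0 : 0 <= x by rewrite (le_trans _ (ltW xTk))// /T0; lra.
have xD2 : x / D <= x / 2 by rewrite ler_wpM2l//; case/andP: i2.
have hW : h <= x / D - M.
  have : D * (`|h| + M) <= x by rewrite /T0 in xTk; lra.
  by rewrite mulrC -ler_pdivlMr; [lra|lra].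
pose W := `[x / D - M, x / D + M]%classic : set R.
have mW : measurable W by exact: measurable_itv.
have tW : tame d h (fun y => chi c * \1_W y).
  apply: tame_le (tame_cst h hd (chi c)) _.
    by apply: measurable_funM => //; exact: measurable_indic.
  move=> y _; rewrite normrM ger0_norm ?(ltW c0)// indicE.
  by case: (_ \in _); rewrite ?normr1 ?normr0 ?mulr1// mulr0 ltW.
have : Lop d h (fun y => chi c * \1_W y) x <= Lop d h chi x.
  apply: Lop_le => //; first exact: tame_chi.
  move=> y hy; rewrite indicE; case: (boolP (y \in W)) => [|_]; last first.
    by rewrite mulr0 (chi_ge0 hchi).
  rewrite inE /W /= in_itv/= => /andP[_ yM]; rewrite mulr1; apply: IH => //.
  move: xTk xT; rewrite /T0; lra.
apply: le_trans.
have t1 : tame d h (\1_W : R -> R).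
  split; first exact: measurable_indic.
  exists 1 => y _; rewrite mul1r (@le_trans _ _ 1)//.
    by rewrite indicE; case: (_ \in _); rewrite ?normr1 ?normr0.
  by rewrite exprn_ege1// growth_ge1.
rewrite LopZ// ler_peMr ?(ltW c0)// /Lop.
have -> : wint h (fun y => @rho_Y R d (y - x / D)) \1_W =
    \int[leb]_(y in W) @rho_Y R d (y - x / D).
  rewrite /wint (_ : W = half_line h `&` W); last first.
    apply/seteqP; split=> [y Wy|y []//]; split=> //; apply/half_lineP.
    by move: Wy; rewrite /W /= in_itv/= => /andP[+ _]; exact: le_trans.
  rewrite Rintegral_mkcondr; apply: eq_Rintegral => y /set_mem hy.
  rewrite patchE indicE in_setI mem_set//=.
  by case: ifPn => _; rewrite ?mul1r ?mul0r.
by have := hM (x / D); rewrite -/W; nra.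
Qed.

End eigenfunction_bounds.

(** * The operator contracts towards the eigenfunction *)

Section contraction.
Context {R : realType} (d : nat) (h : R) (chi : R -> R).
Hypothesis hd : (2 <= d)%N.
Hypothesis hchi : normalized_eigenfunction d h chi.
Notation leb := (@lebesgue_measure R).
Notation D := (d%:R : R).
Notation W := (fun y : R => growth d y ^+ 2).

Let tW : tame d h W. Proof. exact: tame_growth_pow. Qed.
Let tchi : tame d h chi. Proof. exact: tame_chi. Qed.

(** [growth ^+ 2] is a Lyapunov function. The factor [1/8] leaves room for halving
    the rates [1 / n] in the lower bound on survival. *)
Lemma Lop_drift : exists2 K, 0 < K &
  forall x, h <= x -> Lop d h W x <= 8^-1 * W x + K * chi x.
Proof.
have [C hC] := @Lop_growth R d h hd.
have [c c0 hc] := chi_lower_bound hd hchi.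
exists ((2 * C ^+ 2 + 1) / c) => [|x hx].
  by rewrite divr_gt0// ltr_wpDl// mulr_ge0// sqr_ge0.
apply: (le_trans (hC x)).
have : 2 * C ^+ 2 + 1 <= (2 * C ^+ 2 + 1) / c * chi x.
  rewrite mulrAC ler_pdivlMr// ler_wpM2l ?hc//.
  by rewrite addr_ge0// mulr_ge0// sqr_ge0.
have : 0 <= (growth d x - 4 * C) ^+ 2 by exact: sqr_ge0.
by move: (growth d x) => g; lra.
Qed.

(** A density below [rho_Y (y - x / d)] up to a factor depending on [x] only;
    integrating against it replaces restricting to a compact interval. *)
Definition bump (y : R) : R := expR (- (2 * muY d) * y ^+ 2).
Definition Jint (f : R -> R) : R := wint h bump f.

Let bump_gt0 y : 0 < bump y. Proof. exact: expR_gt0. Qed.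
Let bump_ge0 y : 0 <= bump y. Proof. exact: expR_ge0. Qed.

Let measurable_bump : measurable_fun setT bump.
Proof.
apply: measurableT_comp => //.
by apply: measurable_funM => //; exact: measurable_funX.
Qed.

Let integrable_bump :
  leb.-integrable setT (EFin \o (fun y => growth d y ^+ 4 * bump y)).
Proof.
rewrite (_ : (fun y => _) = (fun y =>
    expR (- (2 * muY d - 4 * lam d / 5) * y ^+ 2 + 0 * y + 0))); last first.
  by apply/funext => y; rewrite growth_expr /bump -expRD; congr expR; ring.
apply: integrable_gaussian.
by have := @muY_gt_lam R d hd 4 isT; have := @muY_gt0 R d hd; lra.
Qed.

Let Jint_ge0 f : (forall y, h <= y -> 0 <= f y) -> 0 <= Jint f.
Proof. exact: wint_ge0. Qed.

Let JintD f g : tame d h f -> tame d h g ->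
  Jint (fun y => f y + g y) = Jint f + Jint g.
Proof. exact: wintD. Qed.

Let JintB f g : tame d h f -> tame d h g ->
  Jint (fun y => f y - g y) = Jint f - Jint g.
Proof. exact: wintB. Qed.

Let JintZ c f : tame d h f -> Jint (fun y => c * f y) = c * Jint f.
Proof. exact: wintZ. Qed.

Let rho_Y_bump x y :
  peakY d * expR (- (2 * muY d * D^-1 ^+ 2) * x ^+ 2) * bump y <=
  @rho_Y R d (y - x / D).
Proof.
have p0 := @peakY_gt0 R d hd.
rewrite rho_YE// -mulrA ler_wpM2l ?(ltW p0)// /bump -expRD ler_expR.
have := mulr_ge0 (ltW (@muY_gt0 R d hd)) (sqr_ge0 (y + x * D^-1)).
lra.
Qed.

(** Since [chi = O(growth)], the sublevel sets of [growth ^+ 2 / chi] are bounded,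
    and on a bounded set the kernel dominates a fixed measure. *)
Lemma Lop_minorization r : exists2 a, 0 < a & forall f x, tame d h f ->
  (forall y, h <= y -> 0 <= f y) -> h <= x -> W x <= r * chi x ->
  a * chi x * Jint f <= Lop d h f x.
Proof.
have [C C0 hC] := chi_growth hd hchi.
have l0 := @lam_gt0 R d hd; have p0 := @peakY_gt0 R d hd.
have m0 := @muY_gt0 R d hd; have d2 := @d_ge2 R d hd.
pose G := 1 + `|r * C|; have G0 : 0 < G by rewrite ltr_pwDl.
pose X2 := 5 * G / lam d.
pose E := expR (- (2 * muY d * D^-1 ^+ 2) * X2) : R.
exists (D * (peakY d * E) / (C * G)) => [|f x tf f0 hx Wx].
  by rewrite divr_gt0 ?mulr_gt0 ?expR_gt0//; lra.
have g0 := growth_gt0 d x; have g1 := growth_ge1 hd x.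
have gG : growth d x <= G.
  rewrite /G (@le_trans _ _ `|r * C|) ?lerDr// (le_trans _ (ler_norm _))//.
  rewrite -(ler_pM2r g0) -expr2 (le_trans Wx)// -mulrA.
  have [r0|r0] := leP 0 r; first by rewrite ler_wpM2l ?hC.
  have cx := chi_gt0 hchi hx.
  have : 0 <= W x by rewrite sqr_ge0.
  have : r * chi x < 0 by rewrite nmulr_rlt0.
  by move=> h1 h2; have := le_lt_trans (le_trans h2 Wx) h1; rewrite ltxx.
have xX : x ^+ 2 <= X2.
  have : 1 + lam d / 5 * x ^+ 2 <= growth d x by exact: expR_ge1Dx.
  move=> h1; rewrite /X2 ler_pdivlMr//.
  have : lam d / 5 * x ^+ 2 <= G by lra.
  lra.
have cG : chi x <= C * G by rewrite (le_trans (hC x hx))// ler_wpM2l// ltW.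
have J0 : 0 <= Jint f by exact: Jint_ge0.
have e0 : 0 <= peakY d * E by rewrite mulr_ge0 ?expR_ge0// ltW.
apply: (@le_trans _ _ (D * (peakY d * E) * Jint f)).
  apply: ler_wpM2r => //.
  by rewrite mulrAC ler_pdivrMr ?mulr_gt0// ler_wpM2l// mulr_ge0//; lra.
rewrite -mulrA /Lop ler_wpM2l// -JintZ//.
apply: le_Rintegral; first exact: measurable_half_line.
- by apply: (tame_integrable measurable_bump bump_ge0 integrable_bump); exact: tameZ.
- exact: (@tame_integrable _ _ _ _ (@measurable_rho_Y_shift R d (x / D))
    (fun y => ltW (rho_Y_gt0 hd (y - x / D))) (integrable_growth_rho_Y hd x) _ tf).
move=> y /half_lineP hy; rewrite [_ * f y]mulrC -mulrA ler_wpM2l ?f0//.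
apply: le_trans (rho_Y_bump x y); rewrite ler_wpM2r// ler_wpM2l ?(ltW p0)//.
rewrite ler_expR !mulNr lerN2 ler_wpM2l//.
by rewrite mulr_ge0 ?sqr_ge0// mulr_ge0// ltW.
Qed.

(** Harris' argument for the Markov kernel [f |-> L (chi f) / chi] : where the
    Lyapunov function is at most [r * chi], subtracting the minorizing measure
    gains a fixed proportion; elsewhere the drift does. The multiple of [chi] to
    subtract is the mass of [f] under the minorizing measure. *)
Lemma Lop_contraction : exists b g : R, [/\ 0 < b, 0 < g, g < 1 &
  forall f M, tame d h f -> 0 <= M ->
    (forall x, h <= x -> `|f x| <= M * (chi x + b * W x)) ->
    exists c, forall x, h <= x ->
      `|Lop d h f x - c * chi x| <= g * M * (chi x + b * W x)].
Proof.
have [K K0 hK] := Lop_drift.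
have J1 : 0 < Jint chi.
  apply: (wint_gt0 measurable_bump bump_ge0 integrable_bump tchi) => y hy.
  by rewrite mulr_gt0// (chi_gt0 hchi).
have JW : 0 <= Jint W by apply: Jint_ge0 => y _; exact: sqr_ge0.
(* [t] measures the cost, on the complement of the small set, of subtracting
   the minorizing measure; the level [7 * K + 4 * K * t] pays for it. *)
pose t := Jint W / (2 * K * Jint chi).
have t0 : 0 <= t by rewrite divr_ge0// ltW// !mulr_gt0.
have [a' a'0 minor] := Lop_minorization (7 * K + 4 * K * t).
pose al := Num.min a' (Jint chi)^-1.
have al0 : 0 < al by rewrite lt_min a'0 invr_gt0.
have ala : al <= a' by rewrite ge_min lexx.
have alJ : al <= (Jint chi)^-1 by rewrite ge_min lexx orbT.
pose a := al * Jint chi.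
have a0 : 0 < a by rewrite mulr_gt0.
have a1 : a <= 1 by rewrite -(mulVf (lt0r_neq0 J1)) ler_wpM2r// ltW.
pose b := a / (2 * K).
have b0 : 0 < b by rewrite divr_gt0// mulr_gt0.
have bK : b * K = a / 2 by rewrite /b; field; rewrite gt_eqF.
have bJW : b * (al * Jint W) = a * al * Jint chi * t.
  by rewrite /b /t; field; rewrite !gt_eqF.
exists b, (1 - a / 4); split=> //; [lra|lra|move=> f M tf M0 fM].
pose g (y : R) := M * (chi y + b * W y).
have tg : tame d h g by apply: tameZ; apply: tameD => //; exact: tameZ.
have Lg x : h <= x -> Lop d h g x = M * (chi x + b * Lop d h W x).
  move=> hx; rewrite LopZ//; last by apply: tameD => //; exact: tameZ.
  by rewrite LopD ?LopZ// ?(Lop_chi hd hchi)//; exact: tameZ.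
have Jg : Jint g = M * (Jint chi + b * Jint W).
  rewrite JintZ//; last by apply: tameD => //; exact: tameZ.
  by rewrite JintD ?JintZ//; exact: tameZ.
exists (al * Jint f) => x hx.
have X0 := chi_gt0 hchi hx.
have W0 : 0 <= W x by exact: sqr_ge0.
have LW := hK x hx.
have gf y : h <= y -> 0 <= g y - f y.
  by move=> hy; rewrite subr_ge0 (le_trans _ (fM y hy))// ler_norm.
have gNf y : h <= y -> 0 <= g y + f y.
  move=> hy; rewrite -[f y]opprK subr_ge0 (le_trans _ (fM y hy))//.
  by rewrite -normrN ler_norm.
have MbW : 0 <= M * (b * W x) by rewrite mulr_ge0// mulr_ge0// ltW.
have MX : 0 <= M * chi x by rewrite mulr_ge0// ltW.
have MbLW : M * (b * Lop d h W x) <= M * (b * W x) / 8 + M * chi x * (a / 2).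
  have -> : M * (b * W x) / 8 + M * chi x * (a / 2) =
      M * (b * (8^-1 * W x + K * chi x)).
    by rewrite -bK; ring.
  by rewrite ler_wpM2l// ler_wpM2l// ltW.
have [Wx|Wx] := leP (W x) ((7 * K + 4 * K * t) * chi x).
  have pos u : tame d h u -> (forall y, h <= y -> 0 <= u y) ->
      al * chi x * Jint u <= Lop d h u x.
    move=> tu u0; apply: le_trans (minor u x tu u0 hx Wx).
    by rewrite ler_wpM2r ?Jint_ge0// ler_wpM2r// ltW.
  have p1 := pos _ (tameB tg tf) gf.
  have p2 := pos _ (tameD tg tf) gNf.
  rewrite JintB// LopB// in p1; rewrite JintD// LopD// in p2.
  apply: (@le_trans _ _ (Lop d h g x - al * chi x * Jint g)).
    by rewrite ler_norml; apply/andP; split; lra.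
  rewrite Lg// Jg.
  have : 0 <= M * chi x * (b * (al * Jint W)).
    by rewrite mulr_ge0// mulr_ge0 ?(ltW b0)// mulr_ge0// ltW.
  have -> : al * chi x * (M * (Jint chi + b * Jint W)) =
    M * chi x * a + M * chi x * (b * (al * Jint W)) by rewrite /a; ring.
  have := mulr_ge0 MX (ltW a0).
  have : M * (b * W x) * a <= M * (b * W x) by rewrite ler_piMr.
  lra.
have p1 := Lop_ge0 hd x gf; have p2 := Lop_ge0 hd x gNf.
rewrite LopB// in p1; rewrite LopD// in p2.
have q1 := Jint_ge0 gf; have q2 := Jint_ge0 gNf.
rewrite JintB// in q1; rewrite JintD// in q2.
have alX : 0 <= al * chi x by rewrite mulr_ge0// ltW.
apply: (@le_trans _ _ (Lop d h g x + al * chi x * Jint g)).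
  have := mulr_ge0 alX q1; have := mulr_ge0 alX q2.
  by rewrite ler_norml => k1 k2; apply/andP; split; lra.
rewrite Lg// Jg.
have -> : al * chi x * (M * (Jint chi + b * Jint W)) =
    M * chi x * a + M * chi x * (b * (al * Jint W)) by rewrite /a; ring.
have : M * chi x * (b * (al * Jint W)) <= M * chi x * (a * t).
  rewrite ler_wpM2l// bJW.
  have -> : a * al * Jint chi * t = a * (a * t) by rewrite {3}/a; ring.
  by rewrite ler_piMl// mulr_ge0// ltW.
have MbWr : M * chi x * (a * (7 / 2 + 2 * t)) <= M * (b * W x).
  have -> : M * chi x * (a * (7 / 2 + 2 * t)) =
      M * (b * ((7 * K + 4 * K * t) * chi x)).
    by rewrite /b; field; rewrite gt_eqF.
  by rewrite ler_wpM2l// ler_wpM2l ?(ltW b0)// ltW.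
have : M * (b * W x) * a <= M * (b * W x) by rewrite ler_piMr.
have := mulr_ge0 (mulr_ge0 MX (ltW a0)) t0.
lra.
Qed.

End contraction.

(** * Power inequalities and a quadratic recursion *)

Section bernoulli.
Context {R : realType}.
Implicit Types s t : R.

Lemma onem_exprn_ge k s : 0 <= s <= 1 -> 1 - k%:R * s <= (1 - s) ^+ k.
Proof.
move=> /andP[s0 s1]; elim: k => [|k IH]; first by rewrite expr0 mul0r subr0.
rewrite exprSr -natr1; apply: le_trans (ler_wpM2r _ IH); last by lra.
have : 0 <= k%:R * s ^+ 2 by rewrite mulr_ge0// sqr_ge0.
lra.
Qed.

Lemma onem_exprn_le k s : 0 <= s <= 1 ->
  (1 - s) ^+ k <= 1 - k%:R * s + k%:R * (k%:R - 1) / 2 * s ^+ 2.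
Proof.
move=> /andP[s0 s1]; elim: k => [|k IH].
  by rewrite expr0 !mul0r subr0 addr0.
rewrite exprSr -natr1; apply: le_trans (ler_wpM2r _ IH) _; first by lra.
case: k {IH} => [|k]; first by lra.
have : 0 <= k.+1%:R * (k.+1%:R - 1) * s ^+ 3.
  by rewrite mulr_ge0 ?exprn_ge0// mulr_ge0// subr_ge0 ler1n.
lra.
Qed.

Lemma onem_exprn_ge3 k s : 0 <= s <= 1 ->
  1 - k%:R * s + k%:R * (k%:R - 1) / 2 * s ^+ 2 - (k%:R * s) ^+ 3
  <= (1 - s) ^+ k.
Proof.
move=> /andP[s0 s1]; elim: k => [|k IH].
  by rewrite expr0 !mul0r expr0n subr0 addr0 subr0.
rewrite [(1 - s) ^+ _]exprSr -[k.+1%:R]natr1; apply: le_trans (ler_wpM2r _ IH); last by lra.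
have k0 : 0 <= k%:R :> R by [].
have s3 : 0 <= s ^+ 3 by rewrite exprn_ge0.
have h1 : 0 <= k%:R ^+ 3 * s ^+ 4 by rewrite mulr_ge0// exprn_ge0.
have h2 : 0 <= (k%:R ^+ 2 * 2 + k%:R * 4 + 1) * s ^+ 3 :> R.
  by rewrite mulr_ge0// addr_ge0// addr_ge0// mulr_ge0// sqr_ge0.
have h3 : 0 <= k%:R ^+ 2 * s ^+ 3 by rewrite mulr_ge0// sqr_ge0.
have h4 : 0 <= k%:R * s ^+ 3 by rewrite mulr_ge0.
lra.
Qed.

Lemma onem_exprn_gap k s : (2 <= k)%N -> 0 <= s <= 1 ->
  1 - k%:R * s + s ^+ 2 <= (1 - s) ^+ k.
Proof.
case: k => [|[|k]]// _ /andP[s0 s1]; elim: k => [|k IH]; first by lra.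
rewrite [(1 - s) ^+ _]exprSr -[k.+3%:R]natr1; apply: le_trans (ler_wpM2r _ IH); last by lra.
have : 0 <= k%:R * s ^+ 2 by rewrite mulr_ge0// sqr_ge0.
have : s ^+ 3 <= s ^+ 2 by rewrite exprS ler_piMl// sqr_ge0.
have := sqr_ge0 s; rewrite -[k.+2]addn2 natrD; lra.
Qed.

End bernoulli.

Section quadratic_recursion.
Context {R : realType}.

(** The increments of [1 / a n] are [beta + O(1/n)], and one concludes by Cesaro's
    theorem. *)
Lemma quadratic_recursion_cvg (a : nat -> R) (beta c C E : R) (N : nat) :
  0 < beta -> 0 < c ->
  (forall n, (N <= n)%N -> c / n.+1%:R <= a n) ->
  (forall n, a n <= C / n.+1%:R) ->
  (forall n, `|a n - a n.+1 - beta * a n ^+ 2| <= E / n.+1%:R ^+ 3) ->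
  n%:R * a n @[n --> \oo] --> beta^-1.
Proof.
move=> b0 c0 hc hC hE.
pose u n := (a (n + N).+1)^-1 - (a (n + N)%N)^-1.
have apos n : (N <= n)%N -> 0 < a n.
  by move=> Nn; rewrite (lt_le_trans _ (hc n Nn))// divr_gt0.
have E0 : 0 <= E.
  by have := le_trans (normr_ge0 _) (hE 0%N); rewrite expr1n divr1.
have C0 : 0 < C.
  by have := lt_le_trans (apos N (leqnn N)) (hC N); rewrite pmulr_lgt0.
pose B := (E + beta * C * (E + beta * C ^+ 2)) / c ^+ 2 * 2.
have u_bound n : `|u n - beta| <= B / n.+1%:R.
  rewrite /u; set k := (n + N)%N.
  have Nk : (N <= k)%N by rewrite leq_addl.
  have ak := apos k Nk; have ak1 := apos k.+1 (leqW Nk).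
  have nk : n.+1%:R <= k.+1%:R :> R by rewrite ler_nat ltnS leq_addr.
  pose y : R := k.+1%:R.
  have y1 : 1 <= y by rewrite /y ler1n.
  have y0 : 0 < y by rewrite (lt_le_trans _ y1).
  have -> : (a k.+1)^-1 - (a k)^-1 - beta =
      ((a k - a k.+1 - beta * a k ^+ 2) + beta * a k * (a k - a k.+1)) /
      (a k * a k.+1).
    by field; rewrite !gt_eqF.
  have num1 := hE k; rewrite -/y in num1.
  have akC := hC k; rewrite -/y in akC.
  have ak2 : a k ^+ 2 <= (C / y) ^+ 2.
    by rewrite lerXn2r// nnegrE ltW// divr_gt0.
  have dif : `|a k - a k.+1| <= (E + beta * C ^+ 2) / y ^+ 2.
    have -> : a k - a k.+1 =
       (a k - a k.+1 - beta * a k ^+ 2) + beta * a k ^+ 2 by ring.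
    apply: le_trans (ler_normD _ _) _.
    rewrite (ger0_norm (mulr_ge0 (ltW b0) (sqr_ge0 _))) mulrDl lerD//.
      apply: (le_trans num1); rewrite ler_wpM2l// lef_pV2 ?posrE ?exprn_gt0//.
      by rewrite ler_weXn2l.
    by rewrite -mulrA ler_wpM2l ?(ltW b0)// (le_trans ak2)// exprMn exprVn.
  have num : `|a k - a k.+1 - beta * a k ^+ 2 + beta * a k * (a k - a k.+1)| <=
      (E + beta * C * (E + beta * C ^+ 2)) / y ^+ 3.
    apply: le_trans (ler_normD _ _) _; rewrite mulrDl lerD//.
    rewrite normrM (ger0_norm (mulr_ge0 (ltW b0) (ltW ak))).
    have -> : beta * C * (E + beta * C ^+ 2) / y ^+ 3 =
        (beta * (C / y)) * ((E + beta * C ^+ 2) / y ^+ 2).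
      by field; rewrite gt_eqF.
    by rewrite ler_pM// ?mulr_ge0 ?(ltW b0) ?(ltW ak)// ler_wpM2l// ltW.
  have den : c ^+ 2 / (2 * y ^+ 2) <= a k * a k.+1.
    have h1 := hc k Nk; have h2 := hc k.+1 (leqW Nk).
    rewrite -/y in h1; rewrite -natr1 -/y in h2.
    have -> : c ^+ 2 / (2 * y ^+ 2) = c / y * (c / (2 * y)).
      by field; rewrite gt_eqF.
    rewrite ler_pM ?divr_ge0 ?(ltW c0) ?(ltW y0) ?mulr_ge0 ?(ltW y0)//.
    apply: le_trans h2; rewrite ler_wpM2l ?(ltW c0)// lef_pV2 ?posrE; lra.
  rewrite normrM normfV (ger0_norm (mulr_ge0 (ltW ak) (ltW ak1))).
  rewrite ler_pdivrMr ?mulr_gt0//.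
  have cy : 0 < c ^+ 2 / (2 * y ^+ 2) by rewrite divr_gt0 ?mulr_gt0 ?exprn_gt0.
  have X0 : 0 <= E + beta * C * (E + beta * C ^+ 2).
    rewrite addr_ge0// mulr_ge0 ?addr_ge0 ?mulr_ge0 ?sqr_ge0// ltW//.
  have B0 : 0 <= B by rewrite /B mulr_ge0// divr_ge0// sqr_ge0.
  apply: (le_trans num); apply: (@le_trans _ _ (B / y * (c ^+ 2 / (2 * y ^+ 2)))).
    by rewrite le_eqVlt; apply/orP; left; apply/eqP; rewrite /B; field; rewrite !gt_eqF.
  apply: ler_pM => //; first by rewrite divr_ge0// ltW.
    exact: ltW.
  by rewrite ler_wpM2l// lef_pV2 ?posrE.
have ucvg : u n @[n --> \oo] --> beta.
  apply/cvgrPdist_le => e e0.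
  have BE : B / n.+1%:R @[n --> \oo] --> 0.
    by rewrite -(mulr0 B); apply: cvgM; [exact: cvg_cst|exact: cvg_harmonic].
  move/cvgrPdist_le : BE => /(_ e e0); apply: filterS => n.
  rewrite sub0r normrN distrC => /(le_trans (ler_norm _)).
  exact: le_trans (u_bound n).
have sumu n : \sum_(0 <= i < n) u i = (a (n + N)%N)^-1 - (a N)^-1.
  elim: n => [|n IH]; first by rewrite big_geq// add0n subrr.
  by rewrite big_nat_recr//= IH /u addSn addrC subrKA.
have := cesaro ucvg; rewrite /arithmetic_mean => mean.
have inva : (n.+1%:R * a (n.+1 + N)%N)^-1 @[n --> \oo] --> beta.
  have h0 : (a N)^-1 / n.+1%:R @[n --> \oo] --> 0.
    by rewrite -(mulr0 (a N)^-1); apply: cvgM; [exact: cvg_cst|exact: cvg_harmonic].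
  rewrite (_ : (fun n => _) =
      fun n => n.+1%:R^-1 * series u n.+1 + (a N)^-1 / n.+1%:R); last first.
    apply/funext => n; rewrite /series /= sumu invfM mulrBr.
    by rewrite [X in _ + X]mulrC subrK.
  by rewrite -[beta]addr0; exact: cvgD mean h0.
have an : n.+1%:R * a (n.+1 + N)%N @[n --> \oo] --> beta^-1.
  rewrite (_ : (fun n => _) = fun n => (n.+1%:R * a (n.+1 + N)%N)^-1^-1).
    exact: cvgV (lt0r_neq0 b0) inva.
  by apply/funext => n; rewrite invrK.
rewrite -(cvg_shiftn (N.+1)).
have nn : (n + N.+1)%:R / n.+1%:R @[n --> \oo] --> (1 : R).
  have h1 : 1 + N%:R / n.+1%:R @[n --> \oo] --> (1 : R).
    rewrite -[X in _ --> X]addr0 -[in X in _ --> X](mulr0 N%:R).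
    apply: cvgD; first exact: cvg_cst.
    by apply: cvgM; [exact: cvg_cst|exact: cvg_harmonic].
  rewrite (_ : (fun n => _) = fun n => 1 + N%:R / n.+1%:R)//.
  apply/funext => n; rewrite addnS -addSn natrD mulrDl divff//.
rewrite -[beta^-1]mul1r.
rewrite (_ : (fun n => _) =
    fun n => (n + N.+1)%:R / n.+1%:R * (n.+1%:R * a (n.+1 + N)%N)).
  exact: cvgM nn an.
by apply/funext => n /=; rewrite mulrA divfK ?pnatr_eq0// addSnnS.
Qed.

End quadratic_recursion.

(** * The survival functions and their order of magnitude *)

Section branching.
Context {R : realType} (d : nat).
Hypothesis hd : (2 <= d)%N.
Notation D := (d%:R : R).

(** The probability that one of [d] independent children survives, as a function of
    the expected number [t] of surviving children. *)
Definition branch (t : R) : R := 1 - (1 - t / D) ^+ d.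
Definition branch_quad : R := (D - 1) / (2 * D).

Let s01 t : 0 <= t <= D -> 0 <= t / D <= 1.
Proof.
have d2 : 2 <= D := @d_ge2 R d hd.
move=> /andP[t0 tD]; rewrite divr_ge0//= ler_pdivrMr ?mul1r//; lra.
Qed.

Lemma branch_quad_ge0 : 0 <= branch_quad.
Proof.
have d2 : 2 <= D := @d_ge2 R d hd.
by rewrite /branch_quad divr_ge0 ?mulr_ge0// ?subr_ge0; lra.
Qed.

Lemma branch_ge0 t : 0 <= t <= D -> 0 <= branch t.
Proof.
move=> /s01/andP[s0 s1]; rewrite subr_ge0.
by apply: exprn_ile1; [rewrite subr_ge0|rewrite gerBl].
Qed.

Lemma branch_le1 t : 0 <= t <= D -> branch t <= 1.
Proof. by move=> /s01/andP[s0 s1]; rewrite gerBl exprn_ge0// subr_ge0. Qed.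

Lemma branch_homo t u : t <= u -> u <= D -> branch t <= branch u.
Proof.
have d2 : 2 <= D := @d_ge2 R d hd.
move=> tu uD; rewrite lerD2l lerN2 lerXn2r// ?nnegrE ?subr_ge0.
- by rewrite ler_pdivrMr ?mul1r//; lra.
- by rewrite ler_pdivrMr ?mul1r//; lra.
- by rewrite lerD2l lerN2 ler_wpM2r// invr_ge0; lra.
Qed.

Let dK t : D * (t / D) = t.
Proof. by have d2 := @d_ge2 R d hd; rewrite mulrC divfK// gt_eqF//; lra. Qed.

Lemma branch_le t : 0 <= t <= D -> branch t <= t.
Proof. by move=> /s01/(onem_exprn_ge d); rewrite dK /branch; lra. Qed.

Let quadE t : D * (D - 1) / 2 * (t / D) ^+ 2 = branch_quad * t ^+ 2.
Proof.
by have d2 := @d_ge2 R d hd; rewrite /branch_quad; field; rewrite gt_eqF//; lra.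
Qed.

Lemma branch_quad_le t : 0 <= t <= D -> t - branch_quad * t ^+ 2 <= branch t.
Proof.
by move=> /s01/(onem_exprn_le d); rewrite dK quadE /branch; lra.
Qed.

Lemma branch_quad_ge t : 0 <= t <= D ->
  branch t <= t - branch_quad * t ^+ 2 + t ^+ 3.
Proof.
by move=> /s01/(onem_exprn_ge3 d); rewrite dK quadE /branch; lra.
Qed.

Lemma branch_gap t : 0 <= t <= D -> branch t <= t - t ^+ 2 / D ^+ 2.
Proof.
by move=> /s01/(onem_exprn_gap hd); rewrite dK exprMn exprVn /branch; lra.
Qed.

End branching.

(** The probability, from the value [x] at a vertex with [d] children, that the
    field stays above [h] along a line of [n] generations. *)
Fixpoint survival {R : realType} (d : nat) (h : R) (n : nat) (x : R) : R :=
  if h <= x then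
    if n is m.+1 then branch d (Lop d h (survival d h m) x) else 1
  else 0.

Section survival_bounds.
Context {R : realType} (d : nat) (h : R).
Hypothesis hd : (2 <= d)%N.
Notation leb := (@lebesgue_measure R).
Notation D := (d%:R : R).
Notation q := (survival d h).

Lemma survivalS n x : h <= x -> q n.+1 x = branch d (Lop d h (q n) x).
Proof. by move=> hx; rewrite /= hx. Qed.

Lemma survival0 x : h <= x -> q 0 x = 1. Proof. by move=> hx; rewrite /= hx. Qed.

Lemma survival_out n x : x < h -> q n x = 0.
Proof. by case: n => [|n] hx /=; rewrite leNgt hx. Qed.

Lemma Lop1_le x : Lop d h (fun=> 1) x <= D.
Proof.
rewrite -lee_fin -(Lop_EFin hd x (tame_cst h hd 1)).
rewrite -[leRHS]mule1 lee_wpmul2l//.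
have -> : 1%E = (\int[leb]_y (@rho_Y R d (y - x / D))%:E)%E.
  rewrite -(integral_normal_pdf (x / D) (sigma_Y R d)).
  apply: eq_integral => y _; congr EFin.
  by rewrite /rho_Y !normal_pdfE ?sigma_Y_neq0// /normal_fun subr0.
under eq_integral do rewrite mul1r.
apply: ge0_subset_integral => //; first exact: measurable_half_line.
  by apply/measurable_EFinP; exact: measurable_rho_Y_shift.
by move=> y _; rewrite lee_fin ltW// rho_Y_gt0.
Qed.

Lemma measurable_fun_ge : measurable_fun setT (fun x : R => h <= x).
Proof. by apply: measurable_fun_ler => //; exact: measurable_cst. Qed.

Lemma survival_facts n : [/\ forall x, 0 <= q n x, forall x, q n x <= 1,
  tame d h (q n) & forall x, 0 <= Lop d h (q n) x <= D].
Proof.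
elim: n => [|n [q0 q1 tq Lq]].
  have q0 x : 0 <= q 0 x by rewrite /=; case: ifP.
  have q1 x : q 0 x <= 1 by rewrite /=; case: ifP.
  have tq : tame d h (q 0).
    apply: (tame_le _ (tame_cst h hd 1)) => [|y _]; last by rewrite ger0_norm.
    apply: measurable_fun_ifT => //; exact: measurable_fun_ge.
  split=> // x; apply/andP; split; first exact: Lop_ge0.
  apply: (le_trans _ (Lop1_le x)).
  by apply: Lop_le => //; exact: tame_cst.
have q0' x : 0 <= q n.+1 x.
  have [hx|hx] := leP h x; last by rewrite survival_out.
  by rewrite survivalS// branch_ge0.
have q1' x : q n.+1 x <= 1.
  have [hx|hx] := leP h x; last by rewrite survival_out.
  by rewrite survivalS// branch_le1.
have tq' : tame d h (q n.+1).
  apply: (tame_le _ (tame_cst h hd 1)) => [|y _]; last by rewrite ger0_norm.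
  apply: measurable_fun_ifT => //; first exact: measurable_fun_ge.
  apply: measurable_funB => //; apply: measurable_funX.
  apply: measurable_funB => //; apply: measurable_funM => //.
  exact: measurable_Lop.
split=> // x; apply/andP; split; first exact: Lop_ge0.
apply: (le_trans _ (Lop1_le x)).
by apply: Lop_le => //; exact: tame_cst.
Qed.

Lemma survival_ge0 n x : 0 <= q n x. Proof. by case: (survival_facts n). Qed.
Lemma survival_le1 n x : q n x <= 1. Proof. by case: (survival_facts n). Qed.
Lemma tame_survival n : tame d h (q n). Proof. by case: (survival_facts n). Qed.
Lemma Lop_survival n x : 0 <= Lop d h (q n) x <= D.
Proof. by case: (survival_facts n). Qed.

End survival_bounds.

Section survival_rate.
Context {R : realType} (d : nat) (h : R) (chi : R -> R).
Hypothesis hd : (2 <= d)%N.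
Hypothesis hchi : normalized_eigenfunction d h chi.
Notation leb := (@lebesgue_measure R).
Notation D := (d%:R : R).
Notation q := (survival d h).
Notation W := (fun y : R => growth d y ^+ 2).

Let tW : tame d h W. Proof. exact: tame_growth_pow. Qed.
Let tchi : tame d h chi. Proof. exact: tame_chi. Qed.
Let tq n : tame d h (q n). Proof. exact: tame_survival. Qed.

(** [A / n * chi] is a supersolution of the recursion: since [chi] is bounded away
    from zero, the quadratic gain [branch t <= t - (t / d)^2] dominates a multiple
    of [chi / n^2]; where [A / n * chi > d], the bound by 1 is enough. *)
Lemma survival_le_chi : exists2 A, 0 < A &
  forall n x, h <= x -> q n x <= A / n.+1%:R * chi x.
Proof.
have d2 : 2 <= D := @d_ge2 R d hd.
have [c c0 hc] := chi_lower_bound hd hchi.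
pose A := D ^+ 2 / c; have A0 : 0 < A by rewrite divr_gt0 ?exprn_gt0//; lra.
have Ac : A * c = D ^+ 2 by rewrite divfK// gt_eqF.
exists A => //; elim=> [|n IH] x hx.
  rewrite survival0// divr1 (@le_trans _ _ (A * c))//.
    by rewrite Ac exprn_ege1//; lra.
  by rewrite ler_wpM2l ?hc// ltW.
rewrite survivalS//; set u := Lop d h (q n) x.
have /andP[u0 uD] : 0 <= u <= D by exact: Lop_survival.
pose y : R := n.+1%:R; have y1 : 1 <= y by rewrite ler1n.
rewrite -natr1 -/y; set v := A / y * chi x.
have uv : u <= v.
  rewrite /u /v -(Lop_chi hd hchi hx) -LopZ//.
  by apply: Lop_le => //; exact: tameZ.
have X0 := chi_gt0 hchi hx.
have v0 : 0 < v by rewrite mulr_gt0// divr_gt0//; lra.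
have -> : A / (y + 1) * chi x = v - v / (y + 1).
  by rewrite /v; field; rewrite !gt_eqF//; lra.
have vy : v / (y + 1) <= v / 2.
  by rewrite ler_wpM2l ?(ltW v0)// lef_pV2 ?posrE//; lra.
have [vD|vD] := leP v D; last first.
  by apply: (le_trans (branch_le1 hd _)); rewrite ?u0 ?uD//; lra.
apply: (le_trans (branch_homo hd uv vD)).
apply: (le_trans (branch_gap hd _)); first by rewrite vD ltW.
rewrite lerD2l lerN2.
apply: (@le_trans _ _ (v / y)).
  by rewrite ler_wpM2l ?(ltW v0)// lef_pV2 ?posrE//; lra.
rewrite expr2 -mulrA ler_wpM2l ?(ltW v0)//.
rewrite ler_pdivlMr ?exprn_gt0//; last by lra.
have -> : y^-1 * D ^+ 2 = A / y * c by rewrite -Ac; ring.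
by rewrite /v ler_wpM2l ?hc// divr_ge0 ?ltW//; lra.
Qed.

(** [th * chi - B * th^2 * growth ^+ 2] with [th = e / n] is a subsolution: the
    drift of the Lyapunov function absorbs the quadratic loss [chi^2], at the price
    of a term in [chi] that is paid by the decrease of [th]. *)
Lemma survival_ge_chi : exists e B, [/\ 0 < e, 0 <= B &
  forall n x, h <= x ->
    e / n.+1%:R * chi x - B / n.+1%:R ^+ 2 * W x <= q n x].
Proof.
have d2 : 2 <= D := @d_ge2 R d hd.
have [K K0 hK] := Lop_drift hd hchi.
have [C C0 hC] := chi_growth hd hchi.
pose B := 4 * C ^+ 2; have B0 : 0 < B by rewrite mulr_gt0// exprn_gt0.
(* with this [e] the loss [B * K * th ^+ 2] is at most the decrease of [th] *)
pose e := (2 * B * K)^-1; have e0 : 0 < e by rewrite invr_gt0 !mulr_gt0.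
have eBK : e * (B * K) = 2^-1 by rewrite /e; field; rewrite !gt_eqF.
have chi2 x : h <= x -> chi x ^+ 2 <= C ^+ 2 * W x.
  move=> hx; rewrite -exprMn lerXn2r ?nnegrE ?hC//.
    exact: (chi_ge0 hchi).
  by rewrite mulr_ge0 ?(ltW C0)// ltW// growth_gt0.
exists e, (B * e ^+ 2); split=> //; first by rewrite mulr_ge0 ?sqr_ge0// ltW.
have bq : branch_quad d <= 2^-1 :> R.
  by rewrite /branch_quad ler_pdivrMr; lra.
elim=> [|n IH] x hx.
  rewrite survival0// !divr1 expr1n divr1.
  have := chi2 x hx => /(ler_wpM2l (sqr_ge0 e)).
  have : 0 <= e ^+ 2 * (C ^+ 2 * W x) by apply: mulr_ge0; [|apply: mulr_ge0]; exact: sqr_ge0.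
  have := sqr_ge0 (e * chi x / 2 - 1); rewrite /B.
  move: (W x) (chi x) => w X; lra.
rewrite survivalS//; set u := Lop d h (q n) x.
have /andP[u0 uD] : 0 <= u <= D by exact: Lop_survival.
pose y : R := n.+1%:R; have y1 : 1 <= y by rewrite ler1n.
pose th := e / y; have th0 : 0 < th by rewrite divr_gt0//; lra.
pose s := th * chi x - B * th ^+ 2 * Lop d h W x.
have BthE : B * e ^+ 2 / y ^+ 2 = B * th ^+ 2.
  by rewrite /th; field; rewrite gt_eqF//; lra.
have su : s <= u.
  have t1 := tameZ th tchi; have t2 := tameZ (B * th ^+ 2) tW.
  rewrite /s -(Lop_chi hd hchi hx) -(LopZ hd th x tchi).
  rewrite -(LopZ hd (B * th ^+ 2) x tW) -(LopB hd x t1 t2).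
  apply: Lop_le => //; first exact: tameB.
  by move=> z hz; have := IH z hz; rewrite -/y BthE.
have X0 := chi_gt0 hchi hx; have W0 : 0 <= W x by exact: sqr_ge0.
have LW0 : 0 <= Lop d h W x by apply: Lop_ge0 => // z _; exact: sqr_ge0.
have sX : s <= th * chi x.
  by rewrite gerBl mulr_ge0// mulr_ge0 ?sqr_ge0// ltW.
have low : s - 2^-1 * (th ^+ 2 * chi x ^+ 2) <= branch d u.
  have [s0|s0] := leP s 0.
    apply: (@le_trans _ _ 0); last by apply: branch_ge0; rewrite ?u0.
    by have := mulr_ge0 (sqr_ge0 th) (sqr_ge0 (chi x)); lra.
  apply: le_trans (branch_homo hd su uD).
  apply: le_trans (branch_quad_le hd _); last by rewrite (ltW s0) (le_trans su).
  rewrite lerD2l lerN2 -exprMn ler_pM ?branch_quad_ge0 ?sqr_ge0//.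
  by rewrite lerXn2r ?nnegrE// ltW// mulr_gt0.
apply: le_trans low.
pose th' := e / (y + 1).
rewrite -[n.+2%:R]natr1 -/y -/th'.
have -> : B * e ^+ 2 / (y + 1) ^+ 2 = B * th' ^+ 2.
  by rewrite /th'; field; rewrite gt_eqF//; lra.
have t1 : th / 2 <= th'.
  rewrite /th /th' -mulrA ler_wpM2l ?(ltW e0)// -invfM lef_pV2 ?posrE; lra.
have t2 : B * K * th ^+ 2 <= th - th'.
  have -> : B * K * th ^+ 2 = e / (2 * y ^+ 2).
    have -> : B * K * th ^+ 2 = e * (B * K) * (e / y ^+ 2).
      by rewrite /th; field; rewrite gt_eqF//; lra.
    by rewrite eBK; field; rewrite gt_eqF//; lra.
  have -> : th - th' = e / (y * (y + 1)).
    by rewrite /th /th'; field; rewrite !gt_eqF//; lra.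
  by rewrite ler_wpM2l ?(ltW e0)// lef_pV2 ?posrE ?mulr_gt0 ?exprn_gt0//; nra.
have t3 : (th / 2) ^+ 2 <= th' ^+ 2.
  by rewrite lerXn2r ?nnegrE// ?divr_ge0 ?(ltW th0)// ?(ltW e0)//; lra.
have LW := hK x hx; have c2 := chi2 x hx.
have B_th : 0 <= B * th ^+ 2 by rewrite mulr_ge0 ?sqr_ge0// ltW.
have := ler_wpM2l B_th LW.
have := ler_wpM2l (sqr_ge0 th) c2.
have := ler_wpM2r (ltW X0) t2.
have := ler_wpM2r W0 (ler_wpM2l (ltW B0) t3).
rewrite /s /B; move: (Lop d h W x) (W x) (chi x) => l w X.
lra.
Qed.

End survival_rate.

(** * The survival functions align with the eigenfunction *)

Section survival_asymptotics.
Context {R : realType} (d : nat) (h : R) (chi : R -> R).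
Hypothesis hd : (2 <= d)%N.
Hypothesis hchi : normalized_eigenfunction d h chi.
Notation D := (d%:R : R).
Notation q := (survival d h).
Notation W := (fun y : R => growth d y ^+ 2).

Let tW : tame d h W. Proof. exact: tame_growth_pow. Qed.
Let tchi : tame d h chi. Proof. exact: tame_chi. Qed.
Let tq n : tame d h (q n). Proof. exact: tame_survival. Qed.

(** The coordinate of the survival function along [chi]. *)
Definition overlap (n : nat) : R := nu_int d h (fun x => q n x * chi x).
Definition chi_cube : R := nu_int d h (fun x => chi x ^+ 3).

Let Gn_le m n x : (m <= n)%N -> growth d x ^+ m <= growth d x ^+ n :> R.
Proof. by move=> mn; rewrite ler_weXn2l// growth_ge1. Qed.

Lemma tame_mul_chi (f : R -> R) (C : R) : measurable_fun setT f ->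
  (forall x, h <= x -> `|f x| <= C * growth d x ^+ 3) ->
  tame d h (fun x => f x * chi x).
Proof.
move=> mf fC; have [C' C'0 hC'] := chi_growth hd hchi.
apply: (@tame_of_growth _ _ _ hd _ 4 (C * C')) => //.
  by apply: measurable_funM => //; exact: (chi_measurable hchi).
move=> x hx; rewrite normrM (ger0_norm (chi_ge0 hchi x)) exprSr mulrACA.
by rewrite ler_pM// ?(chi_ge0 hchi)// ?fC ?hC'.
Qed.

Lemma tame_survival_chi n : tame d h (fun x => q n x * chi x).
Proof.
apply: (@tame_mul_chi _ 1); first by case: (tq n).
move=> x _; rewrite mul1r ger0_norm ?survival_ge0// (le_trans (survival_le1 h hd n x))//.
by rewrite exprn_ege1// growth_ge1.
Qed.

Lemma tame_chi_sq : tame d h (fun x => chi x * chi x).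
Proof.
have [C C0 hC] := chi_growth hd hchi.
apply: (@tame_mul_chi _ C); first exact: (chi_measurable hchi).
move=> x hx; rewrite ger0_norm ?(chi_ge0 hchi)// (le_trans (hC x hx))//.
by rewrite ler_wpM2l ?(ltW C0)// -[leLHS]expr1 Gn_le.
Qed.

Lemma tame_chi_cube : tame d h (fun x => chi x ^+ 3).
Proof.
have [C C0 hC] := chi_growth hd hchi.
apply: (@tame_of_growth _ _ _ hd _ 3 (C ^+ 3)) => //.
  by apply: measurable_funX; exact: (chi_measurable hchi).
move=> x hx; rewrite -exprMn normrX (ger0_norm (chi_ge0 hchi x)).
rewrite lerXn2r ?nnegrE ?hC// ?(chi_ge0 hchi)//.
by rewrite mulr_ge0 ?(ltW C0)// ltW// growth_gt0.
Qed.

Lemma chi_cube_gt0 : 0 < chi_cube.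
Proof.
apply: (nu_int_gt0 hd tame_chi_cube) => x hx.
by rewrite exprn_gt0// (chi_gt0 hchi).
Qed.

(* With the shift [m], the rate [1 / (n + m)^2] decreases slower than a geometric
   sequence of ratio [g]. *)
Let shift (g : R) : 0 < g < 1 -> exists m : nat, (0 < m)%N /\
  forall n : nat, (1 + g) / 2 / (n + m)%:R ^+ 2 <= 1 / (n + m).+1%:R ^+ 2.
Proof.
move=> /andP[g0 g1]; have g1' : 0 < 1 - g by lra.
have real_shift (z : R) : 0 < z -> 8 < z * (1 - g) ->
    (1 + g) / 2 / z ^+ 2 <= 1 / (z + 1) ^+ 2.
  move=> z0 hz; have z1 : 0 < z + 1 by lra.
  rewrite ler_pdivlMr ?exprn_gt0// mulrAC ler_pdivrMr ?exprn_gt0// mul1r.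
  have : 8 * z <= z * (1 - g) * z by rewrite ler_wpM2r ?(ltW z0)// ltW.
  have : g * z <= z by rewrite ler_piMl ?(ltW z0)// ltW.
  have : 8 <= z by rewrite (le_trans (ltW hz))// ler_piMr ?(ltW z0)//; lra.
  lra.
pose m := (Num.truncn (8 / (1 - g))).+1.
exists m; split=> // n.
have hm : 8 / (1 - g) < (n + m)%:R.
  by apply: (lt_le_trans (truncnS_gt _)); rewrite ler_nat leq_addl.
rewrite -[(n + m).+1%:R]natr1; apply: real_shift; first by rewrite ltr0n addn_gt0 orbT.
by rewrite -ltr_pdivrMr.
Qed.

(** One step of the recursion is one step of the operator, which contracts, up to
    an error at most [(L q)^2], hence [O(chi^2 / n^2)], by [survival_le_chi]. *)
Lemma survival_near_ray : exists2 B, 0 < B & forall n, exists c,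
  forall x, h <= x -> `|q n x - c * chi x| <= B / n.+1%:R ^+ 2 * W x.
Proof.
have [b [g [b0 g0 g1 contr]]] := Lop_contraction hd hchi.
have [A A0 hA] := survival_le_chi hd hchi.
have [C C0 hC] := chi_growth hd hchi.
have [c0 c00 hc0] := chi_lower_bound hd hchi.
have g01 : 0 < g < 1 by rewrite g0.
have [m [m0 hm]] := shift g01.
pose m' : R := m%:R; have m1 : 1 <= m' by rewrite ler1n.
pose C1 := (A * C) ^+ 2 / b.
have C10 : 0 <= C1 by rewrite divr_ge0 ?sqr_ge0// ltW.
(* the first term settles [n = 0], the second absorbs the nonlinear error *)
pose B := m' ^+ 2 / c0 + C1 * m' ^+ 2 * 2 / (1 - g).
have g1' : 0 < 1 - g by lra.
have Bt : 0 <= C1 * m' ^+ 2 * 2 / (1 - g).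
  by rewrite divr_ge0 ?(ltW g1')// mulr_ge0// mulr_ge0 ?sqr_ge0.
have Bs : 0 < m' ^+ 2 / c0 by rewrite divr_gt0// exprn_gt0//; lra.
have B0 : 0 < B by rewrite ltr_wpDr.
have X0 x : h <= x -> 0 < chi x by move=> hx; exact: (chi_gt0 hchi).
have W0 x : 0 <= W x by exact: sqr_ge0.
have e0 x : h <= x -> 0 <= chi x + b * W x.
  by move=> hx; rewrite addr_ge0 ?(ltW (X0 _ hx))// mulr_ge0// ltW.
have main n : exists c, forall x, h <= x ->
    `|q n x - c * chi x| <= B / (n + m)%:R ^+ 2 * (chi x + b * W x).
  elim: n => [|n [c IH]].
    exists 0 => x hx; rewrite mul0r subr0 survival0// normr1 add0n -/m'.
    apply: (@le_trans _ _ (m' ^+ 2 / c0 / m' ^+ 2 * c0)).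
      by rewrite le_eqVlt; apply/orP; left; apply/eqP; field; rewrite !gt_eqF//; lra.
    apply: ler_pM; rewrite ?(ltW c00)//.
    - by rewrite divr_ge0 ?(ltW Bs)// sqr_ge0.
    - by rewrite ler_wpM2r ?invr_ge0 ?sqr_ge0// lerDl.
    - by rewrite (le_trans (hc0 x hx))// lerDl mulr_ge0// ltW.
  set z : R := (n + m)%:R in IH.
  have z0 : 0 < z by rewrite ltr0n addn_gt0 m0 orbT.
  have tf : tame d h (fun y => q n y - c * chi y) by apply: tameB => //; exact: tameZ.
  have M0 : 0 <= B / z ^+ 2 by rewrite divr_ge0 ?sqr_ge0// ltW.
  have [c1 hc1] := contr _ _ tf M0 IH.
  exists (c + c1) => x hx.
  have := hc1 x hx; rewrite (LopB hd)//; last exact: tameZ.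
  rewrite (LopZ hd)// (Lop_chi hd hchi hx).
  set u := Lop d h (q n) x => hu.
  have /andP[u0 uD] : 0 <= u <= D by exact: Lop_survival.
  have uA : u <= A / n.+1%:R * chi x.
    rewrite /u -(Lop_chi hd hchi hx) -(LopZ hd (A / n.+1%:R) x tchi).
    by apply: Lop_le => //; [exact: tameZ|exact: hA].
  have u2 : u ^+ 2 <= C1 / n.+1%:R ^+ 2 * (chi x + b * W x).
    apply: (@le_trans _ _ (C1 / n.+1%:R ^+ 2 * (b * W x))); last first.
      apply: ler_wpM2l; first by rewrite divr_ge0// sqr_ge0.
      by rewrite lerDr ltW// X0.
    have -> : C1 / n.+1%:R ^+ 2 * (b * W x) = (A / n.+1%:R * (C * growth d x)) ^+ 2.
      by rewrite /C1; field; rewrite !gt_eqF.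
    have AC0 : 0 <= A / n.+1%:R by rewrite divr_ge0// ltW.
    apply: lerXn2r; rewrite ?nnegrE//.
      by rewrite mulr_ge0// mulr_ge0 ?(ltW C0)// ltW// growth_gt0.
    by rewrite (le_trans uA)// ler_wpM2l// hC.
  have qu : `|q n.+1 x - u| <= u ^+ 2.
    rewrite survivalS// -/u.
    have h1 := branch_le hd (_ : 0 <= u <= D); have h2 := branch_quad_le hd (_ : 0 <= u <= D).
    rewrite u0 uD in h1 h2; have {}h1 := h1 isT; have {}h2 := h2 isT.
    have bq : branch_quad d <= 1 :> R.
      have d2 := @d_ge2 R d hd.
      by rewrite /branch_quad ler_pdivrMr; lra.
    have := ler_wpM2r (sqr_ge0 u) bq.
    by rewrite ler_norml => h3; apply/andP; split; lra.
  have key : g * (B / z ^+ 2) + C1 / n.+1%:R ^+ 2 <= B / (n.+1 + m)%:R ^+ 2.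
    have k1 := hm n; rewrite -/z -addSn in k1.
    have k2 : C1 / n.+1%:R ^+ 2 <= (1 - g) / 2 * (B / z ^+ 2).
      have zm : z <= m' * n.+1%:R.
        rewrite /z /m' -natrM ler_nat mulnS addnC leq_add2l.
        by rewrite leq_pmull.
      have y0 : 0 < n.+1%:R :> R by [].
      apply: (@le_trans _ _ (C1 * m' ^+ 2 / z ^+ 2)).
        rewrite -mulrA ler_wpM2l// ler_pdivlMr ?exprn_gt0// mulrC.
        rewrite ler_pdivrMr ?exprn_gt0// -exprMn lerXn2r ?nnegrE ?(ltW z0)//.
        by rewrite mulr_ge0//; lra.
      rewrite [leRHS]mulrA; apply: ler_wpM2r; first by rewrite invr_ge0 sqr_ge0.
      have -> : C1 * m' ^+ 2 = (1 - g) / 2 * (C1 * m' ^+ 2 * 2 / (1 - g)).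
        by field; rewrite gt_eqF.
      by rewrite ler_wpM2l ?lerDr ?(ltW Bs)// divr_ge0// ltW.
    have gen (p r w : R) : r <= (1 - g) / 2 * p -> (1 + g) / 2 * p <= w ->
      g * p + r <= w by lra.
    apply: gen k2 _; have := ler_wpM2l (ltW B0) k1.
    by rewrite mul1r [X in X <= _]mulrCA.
  have -> : q n.+1 x - (c + c1) * chi x =
     (q n.+1 x - u) + (u - c * chi x - c1 * chi x) by ring.
  apply: (le_trans (ler_normD _ _)).
  apply: (le_trans (lerD (le_trans qu u2) hu)); rewrite -mulrDl.
  by apply: ler_wpM2r; [exact: e0|rewrite addrC].
exists (B * (C + b)) => [|n]; first by rewrite mulr_gt0// addr_gt0.
have [c hc] := main n; exists c => x hx.
apply: (le_trans (hc x hx)).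
have -> : B * (C + b) / n.+1%:R ^+ 2 * W x =
  B / n.+1%:R ^+ 2 * (C * W x + b * W x) by ring.
apply: ler_pM; rewrite ?e0//.
- by rewrite divr_ge0 ?sqr_ge0// ltW.
- rewrite ler_wpM2l ?(ltW B0)// lef_pV2 ?posrE ?exprn_gt0 ?ltr0n ?addn_gt0 ?m0 ?orbT//.
  by rewrite lerXn2r ?nnegrE// ler_nat -addn1 leq_add2l.
rewrite lerD2r (le_trans (hC x hx))// ler_wpM2l ?(ltW C0)//.
by rewrite -[leLHS]expr1 Gn_le.
Qed.

End survival_asymptotics.

(** * Asymptotics of the survival functions *)

Section overlap_recursion.
Context {R : realType} (d : nat) (h : R) (chi : R -> R).
Hypothesis hd : (2 <= d)%N.
Hypothesis hchi : normalized_eigenfunction d h chi.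
Notation D := (d%:R : R).
Notation q := (survival d h).
Notation W := (fun y : R => growth d y ^+ 2).
Notation a := (overlap d h chi).

Let tW : tame d h W. Proof. exact: tame_growth_pow. Qed.
Let tchi : tame d h chi. Proof. exact: tame_chi. Qed.
Let tq n : tame d h (q n). Proof. exact: tame_survival. Qed.
Let tqchi n : tame d h (fun x => q n x * chi x).
Proof. exact: (tame_survival_chi hd hchi). Qed.
Let tchi2 : tame d h (fun x => chi x * chi x).
Proof. exact: (tame_chi_sq hd hchi). Qed.
Let tchi3 : tame d h (fun x => chi x ^+ 3).
Proof. exact: (tame_chi_cube hd hchi). Qed.

Let tWchi : tame d h (fun x => growth d x ^+ 2 * chi x).
Proof.
apply: (@tame_mul_chi _ _ _ _ hd hchi _ 1); first exact: measurable_growth.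
move=> x _; rewrite mul1r ger0_norm ?sqr_ge0//.
by rewrite ler_weXn2l// growth_ge1.
Qed.

(** Pairing with [chi] identifies the unspecified multiple of [chi], as [chi] has
    unit norm. *)
Lemma survival_overlap : exists2 B, 0 < B & forall n x, h <= x ->
  `|q n x - a n * chi x| <= B / n.+1%:R ^+ 2 * W x.
Proof.
have [B B0 hB] := survival_near_ray hd hchi.
have [C C0 hC] := chi_growth hd hchi.
pose E1 := nu_int d h (fun x => growth d x ^+ 2 * chi x).
have E10 : 0 <= E1.
  by apply: nu_int_ge0 => // x _; rewrite mulr_ge0 ?sqr_ge0// (chi_ge0 hchi).
exists (B * (1 + E1 * C)) => [|n x hx].
  by rewrite mulr_gt0// ltr_wpDr// mulr_ge0// ltW.
have [c hc] := hB n.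
pose r := B / n.+1%:R ^+ 2; have r0 : 0 <= r by rewrite divr_ge0 ?sqr_ge0// ltW.
have ca : `|a n - c| <= r * E1.
  have -> : a n - c = nu_int d h (fun x => q n x * chi x - c * (chi x * chi x)).
    rewrite nu_intB//; last exact: tameZ.
    by rewrite (nu_intZ hd c tchi2) (nu_int_chi2 hchi) mulr1.
  rewrite -(nu_intZ hd r tWchi); apply: nu_int_norm_le => //.
  - by apply: tameB => //; exact: tameZ.
  - exact: tameZ.
  move=> y hy; rewrite mulrA -mulrBl normrM (ger0_norm (chi_ge0 hchi y)) mulrA.
  by rewrite ler_wpM2r ?(chi_ge0 hchi)// hc.
have -> : q n x - a n * chi x = (q n x - c * chi x) - (a n - c) * chi x by ring.
apply: (le_trans (ler_normB _ _)).
have -> : B * (1 + E1 * C) / n.+1%:R ^+ 2 * W x =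
  r * W x + r * E1 * (C * W x) by rewrite /r; ring.
apply: lerD; first exact: hc.
rewrite normrM (ger0_norm (chi_ge0 hchi x)); apply: ler_pM => //.
  exact: (chi_ge0 hchi).
rewrite (le_trans (hC x hx))// ler_wpM2l ?(ltW C0)//.
by rewrite -[leLHS]expr1 ler_weXn2l// growth_ge1.
Qed.

Lemma Lop_overlap : exists2 B, 0 < B & forall n x, h <= x ->
  `|Lop d h (q n) x - a n * chi x| <= B / n.+1%:R ^+ 2 * W x.
Proof.
have [B B0 hB] := survival_overlap.
have [K K0 hK] := Lop_drift hd hchi.
have [C C0 hC] := chi_growth hd hchi.
exists (B * (8^-1 + K * C)) => [|n x hx].
  by rewrite mulr_gt0// addr_gt0// mulr_gt0.
pose r := B / n.+1%:R ^+ 2; have r0 : 0 <= r by rewrite divr_ge0 ?sqr_ge0// ltW.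
have tac := tameZ (a n) tchi; have trW := tameZ r tW.
have -> : Lop d h (q n) x - a n * chi x = Lop d h (fun y => q n y - a n * chi y) x.
  by rewrite (LopB hd x (tq n) tac) (LopZ hd (a n) x tchi) (Lop_chi hd hchi hx).
apply: (@le_trans _ _ (r * Lop d h W x)).
  rewrite -(LopZ hd r x tW) ler_norml -mulN1r -(LopZ hd (-1) x trW).
  apply/andP; split; apply: Lop_le => //; try exact: tameB; try exact: tameZ.
    by move=> y hy; rewrite mulN1r; have := hB n y hy; rewrite ler_norml => /andP[].
  by move=> y hy; have := hB n y hy; rewrite ler_norml => /andP[].
have -> : B * (8^-1 + K * C) / n.+1%:R ^+ 2 * W x =
  r * (8^-1 * W x + K * (C * W x)) by rewrite /r; ring.
rewrite ler_wpM2l// (le_trans (hK x hx))// lerD2l ler_wpM2l ?(ltW K0)//.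
rewrite (le_trans (hC x hx))// ler_wpM2l ?(ltW C0)//.
by rewrite -[leLHS]expr1 ler_weXn2l// growth_ge1.
Qed.

Lemma overlap_ge0 n : 0 <= a n.
Proof.
apply: nu_int_ge0 => // x hx.
by rewrite mulr_ge0 ?survival_ge0// (chi_ge0 hchi).
Qed.

Lemma overlap_le : exists2 A, 0 < A & forall n, a n <= A / n.+1%:R.
Proof.
have [A A0 hA] := survival_le_chi hd hchi; exists A => // n.
have -> : A / n.+1%:R = A / n.+1%:R * nu_int d h (fun x => chi x * chi x).
  by rewrite (nu_int_chi2 hchi) mulr1.
rewrite -(nu_intZ hd _ tchi2); apply: nu_int_le => //; first exact: tameZ.
move=> x hx; rewrite [leRHS]mulrA.
by apply: ler_wpM2r; [exact: (chi_ge0 hchi)|exact: hA].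
Qed.

Lemma overlap_ge : exists c N, 0 < c /\
  forall n, (N <= n)%N -> c / n.+1%:R <= a n.
Proof.
have [e [B [e0 B0 hB]]] := survival_ge_chi hd hchi.
pose E1 := nu_int d h (fun x => growth d x ^+ 2 * chi x).
have E10 : 0 <= E1.
  by apply: nu_int_ge0 => // x _; rewrite mulr_ge0 ?sqr_ge0// (chi_ge0 hchi).
exists (e / 2), (Num.truncn (2 * B * E1 / e)).+1; split; first exact: divr_gt0.
move=> n Nn; pose y : R := n.+1%:R.
have y0 : 0 < y by [].
have low : e / y - B / y ^+ 2 * E1 <= a n.
  have -> : e / y = e / y * nu_int d h (fun x => chi x * chi x).
    by rewrite (nu_int_chi2 hchi) mulr1.
  rewrite -(nu_intZ hd _ tchi2).
  rewrite -(nu_intZ hd _ tWchi) -nu_intB//; [|exact: tameZ|exact: tameZ].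
  apply: nu_int_le => //; first by apply: tameB; exact: tameZ.
  move=> x hx.
  have -> : e / y * (chi x * chi x) - B / y ^+ 2 * (growth d x ^+ 2 * chi x) =
    (e / y * chi x - B / y ^+ 2 * growth d x ^+ 2) * chi x by ring.
  by apply: ler_wpM2r; [exact: (chi_ge0 hchi)|exact: hB].
apply: le_trans low; rewrite -/y.
have : 2 * B * E1 / e <= y.
  apply: (le_trans (ltW (truncnS_gt _))); rewrite ler_nat.
  exact: leqW.
rewrite ler_pdivrMr// => BE.
rewrite -subr_ge0.
have -> : e / y - B / y ^+ 2 * E1 - e / 2 / y =
  (y * e - 2 * B * E1) / (2 * y ^+ 2) by field; rewrite gt_eqF.
by rewrite divr_ge0 ?subr_ge0// mulr_ge0// sqr_ge0.
Qed.

Notation s := (chi_cube d h chi).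

(** The operator being self-adjoint and [chi] fixed, the overlap changes only
    through the nonlinear part of the recursion, which is
    [branch_quad * (a n * chi)^2] up to [O(1/n^3)]. *)
Lemma overlap_recursion : exists E, forall n,
  `|a n - a n.+1 - branch_quad d * s * a n ^+ 2| <= E / n.+1%:R ^+ 3.
Proof.
have [B B0 hB] := Lop_overlap.
have [A A0 hA] := survival_le_chi hd hchi.
have [A' A'0 hA'] := overlap_le.
have [C C0 hC] := chi_growth hd hchi.
pose b : R := branch_quad d.
have b0 : 0 <= b by exact: branch_quad_ge0.
pose F := (A * C) ^+ 3 + b * B * ((A + A') * C).
have F0 : 0 <= F.
  apply: addr_ge0; first by rewrite exprn_ge0// mulr_ge0// ltW.
  apply: mulr_ge0; first by rewrite mulr_ge0// ltW.
  by rewrite mulr_ge0// ?addr_ge0// ltW.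
pose G4 := nu_int d h (fun x => growth d x ^+ 4).
have tG4 : tame d h (fun x => growth d x ^+ 4) by exact: tame_growth_pow.
exists (F * C * G4) => n.
pose y : R := n.+1%:R; have y0 : 0 < y by [].
have tu : tame d h (Lop d h (q n)).
  apply: (tame_le _ (tame_cst h hd D)).
    apply: measurable_Lop => // z _; exact: survival_ge0.
  by move=> x _; have /andP[u0 uD] := Lop_survival h hd n x; rewrite ger0_norm.
have tuchi : tame d h (fun x => Lop d h (q n) x * chi x).
  apply: (@tame_mul_chi _ _ _ _ hd hchi _ D); first by case: tu.
  move=> x _; have /andP[u0 uD] := Lop_survival h hd n x.
  rewrite ger0_norm// (le_trans uD)// ler_peMr// exprn_ege1// growth_ge1//.
have an : a n = nu_int d h (fun x => Lop d h (q n) x * chi x).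
  rewrite /overlap -[LHS](eq_nu_int d (f := fun x => q n x * Lop d h chi x)).
    rewrite -nu_int_sym//.
    - by apply: eq_nu_int => x _; rewrite mulrC.
    - by move=> x _; exact: survival_ge0.
    - by move=> x _; exact: (chi_ge0 hchi).
  by move=> x hx; rewrite (Lop_chi hd hchi hx).
have -> : a n - a n.+1 - b * s * a n ^+ 2 = nu_int d h (fun x =>
    Lop d h (q n) x * chi x - q n.+1 x * chi x - b * a n ^+ 2 * chi x ^+ 3).
  rewrite (nu_intB hd (tameB tuchi (tqchi n.+1)) (tameZ (b * a n ^+ 2) tchi3)).
  rewrite (nu_intB hd tuchi (tqchi n.+1)) (nu_intZ hd _ tchi3) -an.
  by rewrite -/(a n.+1) -/s; ring.
rewrite [leRHS]mulrAC -(nu_intZ hd _ tG4). apply: nu_int_norm_le => //.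
- by apply: tameB; [exact: tameB|exact: tameZ].
- exact: tameZ.
move=> x hx; have X0 := chi_ge0 hchi x; have cx := hC x hx.
have g0 := growth_gt0 d x; have g1 := growth_ge1 hd x.
rewrite survivalS//; set u := Lop d h (q n) x.
have /andP[u0 uD] : 0 <= u <= D by exact: Lop_survival.
have -> : u * chi x - branch d u * chi x - b * a n ^+ 2 * chi x ^+ 3 =
  (u - branch d u - b * (a n * chi x) ^+ 2) * chi x by ring.
have uA : u <= A / y * chi x.
  rewrite /u -(Lop_chi hd hchi hx) -(LopZ hd (A / y) x tchi).
  by apply: Lop_le => //; [exact: tameZ|exact: hA].
have uG : u <= A * C / y * growth d x.
  have -> : A * C / y * growth d x = A / y * (C * growth d x) by ring.
  by rewrite (le_trans uA)// ler_wpM2l// divr_ge0// ltW.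
have aG : a n * chi x <= A' * C / y * growth d x.
  have -> : A' * C / y * growth d x = A' / y * (C * growth d x) by ring.
  by apply: ler_pM => //; exact: overlap_ge0.
have aX0 : 0 <= a n * chi x by rewrite mulr_ge0// overlap_ge0.
have diff : `|u - a n * chi x| <= B / y ^+ 2 * W x by exact: hB.
(* the remainder of [branch] at second order, then the replacement of [u] by
   [a n * chi x] in the quadratic term *)
have h1 : `|u - branch d u - b * u ^+ 2| <= u ^+ 3.
  have u01 : 0 <= u <= D by rewrite u0.
  have := branch_quad_le hd u01; have := branch_quad_ge hd u01.
  by rewrite -/b ler_norml => k1 k2; apply/andP; split; lra.
have h2 : `|u ^+ 2 - (a n * chi x) ^+ 2| <=
    B / y ^+ 2 * W x * ((A + A') * C / y * growth d x).
  rewrite subr_sqr normrM; apply: ler_pM => //.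
  rewrite ger0_norm ?addr_ge0//.
  have -> : (A + A') * C / y * growth d x =
    A * C / y * growth d x + A' * C / y * growth d x by ring.
  exact: lerD.
rewrite normrM (ger0_norm X0).
have -> : F * C / y ^+ 3 * growth d x ^+ 4 =
  F / y ^+ 3 * growth d x ^+ 3 * (C * growth d x) by ring.
apply: ler_pM => //.
have -> : u - branch d u - b * (a n * chi x) ^+ 2 =
  (u - branch d u - b * u ^+ 2) + b * (u ^+ 2 - (a n * chi x) ^+ 2) by ring.
apply: (le_trans (ler_normD _ _)); rewrite normrM (ger0_norm b0).
have -> : F / y ^+ 3 * growth d x ^+ 3 = (A * C / y * growth d x) ^+ 3 +
    b * (B / y ^+ 2 * W x * ((A + A') * C / y * growth d x)).
  by rewrite /F; field; rewrite gt_eqF.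
apply: lerD; last by rewrite ler_wpM2l.
by apply: (le_trans h1); rewrite lerXn2r ?nnegrE// (le_trans u0).
Qed.

Lemma overlap_cvg : n%:R * a n @[n --> \oo] --> (branch_quad d * s)^-1.
Proof.
have [c [N [c0 hc]]] := overlap_ge; have [A _ hA] := overlap_le.
have [E hE] := overlap_recursion.
apply: (quadratic_recursion_cvg _ c0 hc hA hE).
rewrite mulr_gt0 ?chi_cube_gt0//.
by have d2 := @d_ge2 R d hd; rewrite /branch_quad divr_gt0//; lra.
Qed.

(** Whatever is comparable to [overlap] up to an error [1/n^2] inherits its
    asymptotics. *)
Lemma cvg_of_overlap (f : nat -> R) (al B : R) :
  (forall n, `|f n - al * a n| <= B / n.+1%:R ^+ 2) ->
  n%:R * f n @[n --> \oo] --> al / (branch_quad d * s) /\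
  n.+1%:R * f n @[n --> \oo] --> al / (branch_quad d * s).
Proof.
move=> fB; have [A _ hA] := overlap_le.
have B0 : 0 <= B.
  by have := le_trans (normr_ge0 _) (fB 0%N); rewrite expr1n divr1.
have cvg0 (g : nat -> R) (M : R) : (forall n, `|g n| <= M / n.+1%:R) ->
    g n @[n --> \oo] --> 0.
  move=> gM; apply/cvgrPdist_le => e e0.
  have ME : M / n.+1%:R @[n --> \oo] --> 0.
    by rewrite -(mulr0 M); apply: cvgM; [exact: cvg_cst|exact: cvg_harmonic].
  move/cvgrPdist_le : ME => /(_ e e0); apply: filterS => n.
  rewrite !sub0r !normrN => /(le_trans (ler_norm _)); exact: le_trans (gM n).
have c1 : n%:R * f n @[n --> \oo] --> al / (branch_quad d * s).
  have -> : (fun n => n%:R * f n) =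
      (fun n => al * (n%:R * a n) + n%:R * (f n - al * a n)).
    by apply/funext => n; ring.
  rewrite -[_ / _]addr0; apply: cvgD.
    by apply: cvgM; [exact: cvg_cst|exact: overlap_cvg].
  apply: (cvg0 _ B) => n; rewrite normrM normr_nat.
  apply: (@le_trans _ _ (n.+1%:R * (B / n.+1%:R ^+ 2))).
    by rewrite ler_pM// ler_nat.
  by rewrite le_eqVlt; apply/orP; left; apply/eqP; field.
split=> //.
have -> : (fun n => n.+1%:R * f n) = (fun n => n%:R * f n + f n).
  by apply/funext => n; rewrite -natr1 mulrDl mul1r.
rewrite -[_ / _]addr0; apply: cvgD => //.
apply: (cvg0 _ (B + `|al| * A)) => n.
have -> : f n = (f n - al * a n) + al * a n by ring.
apply: (le_trans (ler_normD _ _)); rewrite mulrDl; apply: lerD.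
  apply: (le_trans (fB n)); rewrite ler_wpM2l// lef_pV2 ?posrE ?exprn_gt0//.
  by rewrite expr2 ler_peMr// ler1n.
by rewrite normrM (ger0_norm (overlap_ge0 n)) -mulrA ler_wpM2l.
Qed.

Lemma survival_cvg x : h <= x ->
  n%:R * q n x @[n --> \oo] --> chi x / (branch_quad d * s).
Proof.
move=> hx; have [B B0 hB] := survival_overlap.
apply: (@cvg_of_overlap _ _ (B * W x) _).1 => n.
by rewrite [chi x * _]mulrC mulrAC hB.
Qed.

Lemma nu_survival_cvg :
  n%:R * nu_int d h (q n) @[n --> \oo] --> nu_int d h chi / (branch_quad d * s).
Proof.
have [B B0 hB] := survival_overlap.
apply: (@cvg_of_overlap _ _ (B * nu_int d h W) _).1 => n.
rewrite [nu_int d h chi * _]mulrC -(nu_intZ hd _ tchi) -nu_intB//; last exact: tameZ.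
rewrite [leRHS]mulrAC -(nu_intZ hd _ tW); apply: nu_int_norm_le => //.
- by apply: tameB => //; exact: tameZ.
- exact: tameZ.
by move=> x hx; exact: hB.
Qed.

(** As [survival], for the root, which has [d + 1] children. *)
Definition root_survival (n : nat) (x : R) : R :=
  if h <= x then
    if n is m.+1 then 1 - (1 - Lop d h (q m) x / D) ^+ d.+1 else 1
  else 0.

Let s01 m x : 0 <= Lop d h (q m) x / D <= 1.
Proof.
have /andP[u0 uD] := Lop_survival h hd m x.
by rewrite divr_ge0//= ler_pdivrMr ?mul1r// ltr0n; case: d hd.
Qed.

Lemma root_survival_ge0 n x : 0 <= root_survival n x.
Proof.
rewrite /root_survival; case: ifP => // _; case: n => // n.
have /andP[u0 u1] := s01 n x; rewrite subr_ge0.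
by apply: exprn_ile1; [rewrite subr_ge0|rewrite gerBl].
Qed.

Lemma tame_root_survival n : tame d h (root_survival n).
Proof.
have mge := @measurable_fun_ge R h.
apply: (tame_le _ (tame_cst h hd 1)) => [|x hx].
  case: n => [|n]; first by apply: measurable_fun_ifT.
  apply: measurable_fun_ifT => //.
  apply: measurable_funB => //; apply: measurable_funX.
  apply: measurable_funB => //; apply: measurable_funM => //.
  by apply: measurable_Lop => // z _; exact: survival_ge0.
rewrite ger0_norm ?root_survival_ge0// /root_survival hx; case: n => // n.
have /andP[u0 u1] := s01 n x.
by rewrite gerBl exprn_ge0// subr_ge0.
Qed.

Lemma root_survival_overlap : exists2 B, 0 < B & forall n x, h <= x ->
  `|root_survival n.+1 x - (D + 1) / D * chi x * a n| <= B / n.+1%:R ^+ 2 * W x.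
Proof.
have [B B0 hB] := Lop_overlap.
have [A A0 hA] := survival_le_chi hd hchi.
have [C C0 hC] := chi_growth hd hchi.
have d2 : 2 <= D := @d_ge2 R d hd.
have d0 : 0 < D by lra.
have dd : 0 <= (D + 1) / D by rewrite divr_ge0; lra.
pose Q := (D + 1) * D / 2 / D ^+ 2.
have Q0 : 0 <= Q by rewrite divr_ge0 ?sqr_ge0// divr_ge0// mulr_ge0; lra.
exists ((D + 1) / D * B + Q * (A * C) ^+ 2) => [|n x hx].
  apply: ltr_pwDl; last by apply: mulr_ge0 => //; exact: sqr_ge0.
  by apply: mulr_gt0 => //; apply: divr_gt0 => //; lra.
rewrite /root_survival hx; set u := Lop d h (q n) x.
have /andP[u0 uD] : 0 <= u <= D by exact: Lop_survival.
have u01 : 0 <= u / D <= 1 by rewrite divr_ge0 ?(ltW d0)//= ler_pdivrMr// mul1r.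
have k1 := onem_exprn_ge d.+1 u01; have k2 := onem_exprn_le d.+1 u01.
rewrite -[d.+1%:R]natr1 in k1 k2.
have e1 : (D + 1) * (u / D) = (D + 1) / D * u by ring.
have e2 : (D + 1) * (D + 1 - 1) / 2 * (u / D) ^+ 2 = Q * u ^+ 2.
  by rewrite /Q; field; rewrite gt_eqF.
rewrite e1 in k1 k2; rewrite e2 in k2.
have near1 : `|1 - (1 - u / D) ^+ d.+1 - (D + 1) / D * u| <= Q * u ^+ 2.
  have Qu : 0 <= Q * u ^+ 2 by rewrite mulr_ge0// sqr_ge0.
  move: k1 k2 Qu; move: ((1 - u / D) ^+ d.+1) ((D + 1) / D * u) (Q * u ^+ 2).
  by move=> v1 v2 v3 k1 k2 k3; rewrite ler_norml; apply/andP; split; lra.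
pose y : R := n.+1%:R; have y0 : 0 < y by [].
have uA : u <= A / y * (C * growth d x).
  apply: (@le_trans _ _ (A / y * chi x)); last first.
    by rewrite ler_wpM2l ?hC// divr_ge0// ltW.
  rewrite /u -(Lop_chi hd hchi hx) -(LopZ hd (A / y) x tchi).
  by apply: Lop_le => //; [exact: tameZ|exact: hA].
have u2 : u ^+ 2 <= (A / y * (C * growth d x)) ^+ 2.
  by rewrite lerXn2r ?nnegrE// (le_trans u0).
have -> : 1 - (1 - u / D) ^+ d.+1 - (D + 1) / D * chi x * a n =
    (1 - (1 - u / D) ^+ d.+1 - (D + 1) / D * u) +
    (D + 1) / D * (u - a n * chi x) by ring.
apply: (le_trans (ler_normD _ _)).
have -> : ((D + 1) / D * B + Q * (A * C) ^+ 2) / y ^+ 2 * W x =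
    Q * (A / y * (C * growth d x)) ^+ 2 + (D + 1) / D * (B / y ^+ 2 * W x).
  by field; rewrite !gt_eqF.
apply: lerD; first by rewrite (le_trans near1)// ler_wpM2l.
by rewrite normrM (ger0_norm dd) ler_wpM2l// hB.
Qed.

Lemma root_survival_cvg x : h <= x -> n%:R * root_survival n x @[n --> \oo] -->
  (D + 1) / D * chi x / (branch_quad d * s).
Proof.
move=> hx; have [B B0 hB] := root_survival_overlap.
rewrite -(cvg_shiftn 1).
have := (@cvg_of_overlap (fun n => root_survival n.+1 x) ((D + 1) / D * chi x)
  (B * W x) (fun n => _)).2.
under [X in _ -> X @ _ --> _]eq_fun do rewrite addn1.
apply => n.
by rewrite [B * W x / _]mulrAC hB.
Qed.

Lemma nu_root_survival_cvg :
  n%:R * nu_int d h (root_survival n) @[n --> \oo] -->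
  (D + 1) / D * nu_int d h chi / (branch_quad d * s).
Proof.
have [B B0 hB] := root_survival_overlap.
rewrite -(cvg_shiftn 1).
have := (@cvg_of_overlap (fun n => nu_int d h (root_survival n.+1))
  ((D + 1) / D * nu_int d h chi) (B * nu_int d h W) (fun n => _)).2.
under [X in _ -> X @ _ --> _]eq_fun do rewrite addn1.
apply => n; have tr := tame_root_survival n.+1.
have -> : (D + 1) / D * nu_int d h chi * a n =
    (D + 1) / D * a n * nu_int d h chi by ring.
rewrite -(nu_intZ hd _ tchi) -nu_intB//; last exact: tameZ.
rewrite [leRHS]mulrAC -(nu_intZ hd _ tW); apply: nu_int_norm_le => //.
- by apply: tameB => //; exact: tameZ.
- exact: tameZ.
by move=> x hx; rewrite mulrAC hB.
Qed.

End overlap_recursion.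

(** * Independent innovations *)

Section freezing.
Context {dsp d2 : measure_display} {Omega : measurableType dsp}
  {T2 : measurableType d2} {R : realType}.
Variables (P : probability Omega R) (X : {RV P >-> R}) (Z : {RV P >-> T2}).
Hypothesis XZ : forall A B, measurable A -> measurable B ->
  P (X @^-1` A `&` Z @^-1` B) = (P (X @^-1` A) * P (Z @^-1` B))%E.

(** The joint law of independent [X] and [Z] is a product measure. *)
Lemma freezing (F : set (R * T2)) : measurable F ->
  P [set w | F (X w, Z w)] =
  (\int[distribution P X]_x P [set w | F (x, Z w)])%E.
Proof.
move=> mF.
pose XZf (w : Omega) : R * T2 := (X w, Z w).
have mXZ : measurable_fun setT XZf.
  by apply: measurable_fun_pair => //; exact: measurable_funPT.
pose m12 : {measure set (R * T2) -> \bar R} :=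
  measure_function_pushforward__canonical__measure_function_Measure P mXZ.
have E A B : measurable A -> measurable B ->
    m12 (A `*` B) = (distribution P X A * distribution P Z B)%E.
  by move=> mA mB; rewrite -XZ.
have := product_measure_unique E mF; rewrite -[RHS]/(P [set w | F (X w, Z w)]) => <-.
by apply: eq_integral => x _; congr (P _); apply/seteqP; split=> w /=;
  rewrite /xsection /= inE.
Qed.

End freezing.

Section cylinders.
Context {R : realType} {d : nat} {dsp : measure_display} {Omega : measurableType dsp}.
Variables (P : probability Omega R) (Y : vertex d -> {RV P >-> R}).
Hypothesis Yind : mutually_independent Y.

(** Sets [B v] are given for all vertices, equal to [setT] off a finite list, so that
    intersections are taken pointwise. The sigma-algebra generated by
    [cylinder S] is the information carried by the innovations indexed by [S]. *)
Definition cylinder (S : set (vertex d)) : set (set Omega) :=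
  [set A | exists (s : seq (vertex d)) (B : vertex d -> set R),
    [/\ forall v, v \in s -> S v, forall v, measurable (B v),
        forall v, v \notin s -> B v = setT
      & A = [set w | forall v, B v (Y v w)]]].

Local Notation info S := (g_sigma_algebraType (cylinder S)).

Lemma setI_closed_cylinder S : setI_closed (cylinder S).
Proof.
move=> _ _ [s [B [sS mB sB ->]]] [s' [B' [sS' mB' sB' ->]]].
exists (s ++ s'), (fun v => B v `&` B' v); split.
- by move=> v; rewrite mem_cat => /orP[/sS|/sS'].
- by move=> v; exact: measurableI.
- by move=> v; rewrite mem_cat negb_or => /andP[/sB -> /sB' ->]; rewrite setIT.
- apply/seteqP; split=> w /=; first by move=> [h1 h2] v; split.
  by move=> hw; split=> v; case: (hw v).
Qed.

Let P_rectangle (s : seq (vertex d)) (B : vertex d -> set R) :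
  (forall v, measurable (B v)) -> (forall v, v \notin s -> B v = setT) ->
  P [set w | forall v, B v (Y v w)] =
  (\prod_(v <- undup s) P (Y v @^-1` B v))%E.
Proof.
move=> mB sB; rewrite -(Yind (undup_uniq s) mB); congr (P _).
apply/seteqP; split=> w /= hw v; first by move=> _; exact: hw.
have [vs|/sB ->//] := boolP (v \in s).
by apply: hw; rewrite mem_undup.
Qed.

Lemma cylinder_measurable S A : cylinder S A -> measurable A.
Proof.
move=> [s [B [_ mB sB ->]]].
rewrite (_ : [set w | _] = \big[setI/setT]_(v <- undup s) (Y v @^-1` B v)).
  apply: bigsetI_measurable => v _; rewrite -[X in measurable X]setTI.
  exact: measurable_funPT.
rewrite -bigcap_seq; apply/seteqP; split=> w /= hw v /=; first by move=> _; exact: hw.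
have [vs|/sB ->//] := boolP (v \in s).
by apply: hw; rewrite /= mem_undup.
Qed.

Let cylinder_indep S S' A A' : [disjoint S & S'] -> cylinder S A -> cylinder S' A' ->
  P (A `&` A') = (P A * P A')%E.
Proof.
move=> /disj_setPS SS' [s [B [sS mB sB ->]]] [s' [B' [sS' mB' sB' ->]]].
rewrite (P_rectangle mB sB) (P_rectangle mB' sB').
have hd v : v \in s -> v \notin s'.
  by move=> vs; apply/negP => vs'; have := SS' v (conj (sS v vs) (sS' v vs')).
rewrite (_ : _ `&` _ = [set w | forall v, (B v `&` B' v) (Y v w)]); last first.
  apply/seteqP; split=> w /=; first by move=> [h1 h2] v; split.
  by move=> hw; split=> v; case: (hw v).
rewrite (@P_rectangle (undup s ++ undup s') (fun v => B v `&` B' v)); first last.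
- move=> v; rewrite mem_cat !mem_undup negb_or => /andP[/sB -> /sB' ->].
  by rewrite setIT.
- by move=> v; exact: measurableI.
rewrite undup_id; last first.
  rewrite cat_uniq !undup_uniq /= andbT; apply/hasPn => v.
  by rewrite !mem_undup => vs'; apply/negP => /hd; rewrite vs'.
rewrite big_cat/=; congr (_ * _)%E.
  apply: eq_big_seq => v; rewrite mem_undup => /hd /sB' ->.
  by rewrite setIT.
apply: eq_big_seq => v; rewrite mem_undup => vs'.
rewrite sB ?setTI//; apply/negP => /hd; by rewrite vs'.
Qed.

Lemma info_measurable S A : <<s cylinder S >> A -> measurable A.
Proof.
have : <<s cylinder S >> `<=` measurable.
  apply: smallest_sub; first exact: sigma_algebra_measurable.
  by move=> B /cylinder_measurable.
exact.
Qed.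

Let indep_extend (G : set (set Omega)) (A' : set Omega) : setI_closed G ->
  G `<=` measurable -> measurable A' ->
  (forall A, G A -> P (A `&` A') = (P A * P A')%E) ->
  forall A, <<s G >> A -> P (A `&` A') = (P A * P A')%E.
Proof.
move=> GI Gm mA' GA' A.
have PA'f : P A' \is a fin_num by exact: fin_num_measure.
suff : <<s G >> `<=` [set A | measurable A /\ P (A `&` A') = (P A * P A')%E].
  by move=> h /h[].
apply: lambda_system_subset; [exact: GI| | |by []].
  apply/dynkin_lambda_system; split.
  - by split=> //; rewrite setTI probability_setT mul1e.
  - move=> B [mB PB]; split; first exact: measurableC.
    rewrite setIC -setDE measureD//; last first.
      by rewrite -ge0_fin_numE// fin_num_measure.
    rewrite [X in (_ - X)%E](_ : _ = P B * P A')%E; last by rewrite setIC; exact: PB.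
    by rewrite probability_setC// muleBl// ?fin_num_adde_defr// mul1e.
  - move=> F tF mF; split; first by apply: bigcup_measurable => k _; have [] := mF k.
    rewrite setI_bigcupl !measure_bigcup//.
    + rewrite muleC -(fineK PA'f) -nneseriesZl//; apply: eq_eseriesr => n _.
      by rewrite fineK// muleC; have [] := mF n.
    + by move=> n _; have [] := mF n.
    + by move=> n _; apply: measurableI => //; have [] := mF n.
    + exact: trivIset_setIr.
by move=> B GB; split; [exact: Gm|exact: GA'].
Qed.

(** The product rule on cylinders extends by two applications of Dynkin's
    lemma, one for each set of vertices. *)
Lemma info_indep S S' A A' : [disjoint S & S'] ->
  <<s cylinder S >> A -> <<s cylinder S' >> A' -> P (A `&` A') = (P A * P A')%E.
Proof.
move=> SS' sA sA'; apply: (indep_extend _ _ _ _ sA).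
- exact: setI_closed_cylinder.
- by move=> B /cylinder_measurable.
- exact: info_measurable sA'.
move=> B cB; rewrite setIC muleC; apply: (indep_extend _ _ _ _ sA').
- exact: setI_closed_cylinder.
- by move=> C /cylinder_measurable.
- exact: cylinder_measurable cB.
by move=> C cC; rewrite setIC muleC; exact: cylinder_indep cB cC.
Qed.

Lemma cylinderS S S' : S `<=` S' -> cylinder S `<=` cylinder S'.
Proof.
move=> SS' A [s [B [sS mB sB ->]]]; exists s, B; split=> //.
by move=> v /sS; exact: SS'.
Qed.

Lemma infoS S S' A : S `<=` S' -> <<s cylinder S >> A -> <<s cylinder S' >> A.
Proof.
move=> SS'; apply: smallest_sub; first exact: smallest_sigma_algebra.
by move=> B /(cylinderS SS'); exact: sub_sigma_algebra.
Qed.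

Lemma info_Y S v A : S v -> measurable A -> <<s cylinder S >> (Y v @^-1` A).
Proof.
move=> Sv mA; apply: sub_gen_smallest.
exists [:: v], (fun u => if u == v then A else setT); split.
- by move=> u; rewrite inE => /eqP ->.
- by move=> u; case: ifP.
- by move=> u; rewrite inE => /negbTE ->.
apply/seteqP; split=> w /=; first by move=> Aw u; case: ifP => [/eqP ->|].
by move=> /(_ v); rewrite eqxx.
Qed.

Lemma info_indep_seq (I : eqType) (s : seq I) (S : I -> set (vertex d))
    (A : I -> set Omega) :
  uniq s -> (forall i j, i != j -> [disjoint S i & S j]) ->
  (forall i, <<s cylinder (S i) >> (A i)) ->
  P (\big[setI/setT]_(i <- s) A i) = (\prod_(i <- s) P (A i))%E.
Proof.
move=> us dS sA.
elim: s us => [_|i s IH /= /andP[is_ us]].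
  by rewrite !big_nil probability_setT.
rewrite !big_cons -IH//.
apply: (@info_indep (S i) (\bigcup_(j in [set j | j \in s]) S j)) => //.
  apply/disj_setPS => v [Siv [j /= js Sjv]].
  have ij : i != j by apply: contraNneq is_ => ->.
  by have /disj_setPS := dS _ _ ij; apply; split; [exact: Siv|exact: Sjv].
elim: s {us is_ IH} => [|j s IH].
  by rewrite big_nil; exact: (@measurableT _ (info _)).
rewrite big_cons.
apply: (@measurableI _ (info _)).
  apply: infoS (sA j) => v Sv; exists j => //=; exact: mem_head.
apply: infoS IH => v [k /= ks Sk]; exists k => //=.
by rewrite inE ks orbT.
Qed.

End cylinders.

(** * Integrals against the normal laws *)

Section translation.
Context {R : realType}.
Notation leb := (@lebesgue_measure R).

(** The image of Lebesgue measure by a translation agrees with it on intervals. *)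
Lemma lebesgue_integral_shift (c : R) (g : R -> \bar R) :
  measurable_fun setT g -> (forall y, 0 <= g y)%E ->
  (\int[leb]_y g (c + y)%R = \int[leb]_y g y)%E.
Proof.
move=> mg g0.
pose sh (y : measurableTypeR R) : measurableTypeR R := c + y.
have msh : measurable_fun [set: measurableTypeR R] sh by exact: measurable_funD.
transitivity (\int[pushforward leb sh]_y g y)%E.
  by rewrite ge0_integral_pushforward.
apply: eq_measure_integral => A mA _; apply/esym.
apply: (@lebesgue_measure_unique R (measure_function_pushforward__canonical__measure_function_Measure leb msh)) => //.
move=> X [[a b] _ <-] /=.
rewrite /pushforward.
rewrite (_ : _ @^-1` _ = `](a - c), (b - c)]%classic); last first.
  by apply/seteqP; split=> y /=; rewrite /sh !in_itv/= => /andP[h1 h2]; apply/andP; split; lra.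
rewrite !lebesgue_measure_itv/= !lte_fin ltrD2r.
by case: ifP => // _; rewrite -!EFinD; congr EFin; ring.
Qed.

End translation.

Section normal_shift.
Context {R : realType} (d : nat) (h : R).
Hypothesis hd : (2 <= d)%N.
Notation leb := (@lebesgue_measure R).
Notation D := (d%:R : R).

Lemma restrict_integral (f w : R -> R) : (forall x, x < h -> f x = 0) ->
  (\int[leb]_y (f y * w y)%:E = \int[leb]_(y in half_line h) (f y * w y)%:E)%E.
Proof.
move=> f0; rewrite [RHS]integral_mkcond; apply: eq_integral => y _.
rewrite patchE; case: ifPn => // /negP yh; rewrite f0 ?mul0r// ltNge.
by apply/negP => hy; apply: yh; rewrite inE; exact/half_lineP.
Qed.

Lemma normal_Y_integral (f : R -> R) (x : R) : tame d h f ->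
  (forall x, 0 <= f x) -> (forall x, x < h -> f x = 0) ->
  (\int[normal_prob 0 (sigma_Y R d)]_y (f (D^-1 * x + y)%R)%:E =
   (Lop d h f x / D)%:E)%E.
Proof.
move=> tf fge0 f0; have [mf _] := tf.
have d0 : 0 < D by have := @d_ge2 R d hd; lra.
rewrite integral_normal_prob; last first.
- by move=> y; rewrite lee_fin.
- apply/measurable_EFinP; apply: (measurableT_comp mf).
  exact: measurable_funD.
transitivity (\int[leb]_y ((f y * @rho_Y R d (y - x / D))%:E))%E.
  rewrite -[RHS](lebesgue_integral_shift (D^-1 * x)).
  - apply: eq_integral => y _; rewrite -EFinM; congr (_ * _)%:E.
    by rewrite [D^-1 * x]mulrC addrAC subrr add0r.
  - apply/measurable_EFinP/measurable_funM => //.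
    exact: measurable_rho_Y_shift.
  - move=> y; by rewrite lee_fin mulr_ge0// ltW// rho_Y_gt0.
rewrite restrict_integral// /Lop [_ * wint _ _ _]mulrC mulfK ?gt_eqF//.
apply: (wint_EFin (w := fun y => @rho_Y R d (y - x / D))) tf.
- exact: measurable_rho_Y_shift.
- by move=> y; rewrite ltW// rho_Y_gt0.
- exact: integrable_growth_rho_Y.
Qed.

Lemma normal_nu_integral (f : R -> R) : tame d h f ->
  (forall x, 0 <= f x) -> (forall x, x < h -> f x = 0) ->
  (\int[normal_prob 0 (sigma_nu R d)]_y (f y)%:E = (nu_int d h f)%:E)%E.
Proof.
move=> tf fge0 f0; have [mf _] := tf.
rewrite integral_normal_prob; last first.
- by move=> y; rewrite lee_fin.
- exact/measurable_EFinP.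
under eq_integral do rewrite -EFinM.
rewrite (restrict_integral (rho_nu d))//.
apply: (wint_EFin (w := rho_nu d)) tf.
- exact: measurable_rho_nu.
- by move=> y; rewrite ltW// rho_nu_gt0.
- exact: integrable_growth_nu.
Qed.

Lemma inner_nuE (f g : R -> R) : tame d h (fun x => f x * g x) ->
  (forall x, 0 <= f x * g x) -> (forall x, x < h -> f x * g x = 0) ->
  inner_nu d f g = nu_int d h (fun x => f x * g x).
Proof.
by move=> tf fg0 fg1; rewrite /inner_nu /Rintegral (normal_nu_integral tf).
Qed.

End normal_shift.

(** * Clusters as surviving lines of descent *)

Section clusters.
Context {R : realType} {d : nat}.
Implicit Types (h x : R) (y phi : vertex d -> R) (i : 'I_d.+1) (w s : seq 'I_d).

Lemma geodesic_cons (v : vertex d) : v != origin ->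
  geodesic v = v :: geodesic (parent v).
Proof. by case: v => [[i w]|]//; rewrite /geodesic depth_parent. Qed.

Lemma geodesic_sub_path (v : vertex d) (p : seq (vertex d)) :
  is_path origin v p -> {subset geodesic v <= origin :: p}.
Proof.
elim/last_ind: p v => [|p u IH] v [].
  by move=> _ /= <- t.
rewrite rcons_path last_rcons => /andP[pp pu] <- {v}.
have IHp := IH _ (conj pp erefl).
move=> t tu; rewrite -rcons_cons mem_rcons inE.
case/orP: pu => /andP[v0 /eqP pv].
  by move: tu; rewrite geodesic_cons// pv inE => /orP[->//|/IHp ->]; rewrite orbT.
apply/orP; right; apply: IHp.
by rewrite geodesic_cons// pv inE tu orbT.
Qed.

(** Every path from the origin to [v] contains the geodesic. *)
Lemma clusterP h phi (v : vertex d) :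
  Defs.cluster h phi v <-> forall u, u \in geodesic v -> h <= phi u.
Proof.
split=> [[p vp /allP hp] u /(geodesic_sub_path vp)|]; first exact: hp.
move: {2}(depth v) (erefl (depth v)) => n.
elim: n v => [|n IH] v vn hv.
  have v0 : v = origin by case: v vn {hv} => [[]|].
  exists [::]; first by rewrite v0.
  by rewrite /= andbT; apply: hv; rewrite v0 mem_head.
have v0 : v != origin by case: v vn {hv}.
rewrite geodesic_cons// in hv.
have [||p [pp lp] ap] := IH (parent v).
- by rewrite depth_parent vn.
- by move=> u up; apply: hv; rewrite inE up orbT.
exists (rcons p v).
  by rewrite /is_path rcons_path pp lp last_rcons /adj v0 eqxx.
by rewrite -rcons_cons all_rcons ap andbT; apply: hv; rewrite mem_head.
Qed.

Lemma iter_parent k i w : iter k parent (Some (i, w) : vertex d) =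
  if (k <= size w)%N then Some (i, drop k w) else None.
Proof.
elim: k => [|k IH]; first by rewrite drop0.
rewrite iterS IH; have [kw|kw] := leqP k (size w); last first.
  by rewrite ltnNge (ltnW kw).
case E: (drop k w) => [|b w'].
  by have := size_drop k w; rewrite E => /esym/eqP; rewrite subn_eq0 ltnNge => ->.
have kw' : (k < size w)%N by rewrite -subn_gt0 -size_drop E.
by rewrite kw' -[k.+1]add1n -drop_drop E /= drop0.
Qed.

Lemma mem_geodesic i w (u : vertex d) : u \in geodesic (Some (i, w)) <->
  u = origin \/ exists2 k, (k <= size w)%N & u = Some (i, drop k w).
Proof.
rewrite /geodesic; split=> [/trajectP[k kw ->]|].
  rewrite iter_parent; case: ifP => [kw'|_]; last by left.
  by right; exists k.
case=> [->|[k kw ->]]; apply/trajectP.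
  by exists (size w).+1 => //; rewrite iter_parent ltnn.
by exists k; [rewrite ltnS ltnW|rewrite iter_parent kw].
Qed.

(** The value [x] is the one at the parent of [(i, w)]: this makes the event depend
    on the innovations of [(i, w)] and of its descendants only. *)
Fixpoint alive h (n : nat) i w x y : Prop :=
  let z := d%:R^-1 * x + y (Some (i, w)) in
  h <= z /\ if n is m.+1 then exists a, alive h m i (a :: w) z y else True.

Let above x y i w : R := if w is _ :: w' then gff_branch x y i w' else x.

Let gff_branchE x y i w :
  gff_branch x y i w = d%:R^-1 * above x y i w + y (Some (i, w)).
Proof. by case: w. Qed.

(** The word is read upwards, most recent letter first, so the descendants of
    [(i, w)] are the [(i, s ++ w)] and the ancestors are obtained by [drop]. *)
Lemma alive_path h n i w x y : alive h n i w (above x y i w) y <->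
  exists2 s, size s = n &
    forall k, (k <= n)%N -> h <= gff_branch x y i (drop k (s ++ w)).
Proof.
elim: n w => [|n IH] w /=; rewrite -gff_branchE.
  split=> [[hw _]|[s /size0nil -> hs]].
    by exists [::] => // k; rewrite leqn0 => /eqP ->; rewrite drop0.
  by split=> //; have := hs 0%N isT; rewrite drop0.
split=> [[hw [a /(IH (a :: w)) [s sn hs]]]|[s sn hs]].
  exists (rcons s a) => [|k kn]; first by rewrite size_rcons sn.
  rewrite cat_rcons; move: kn; rewrite leq_eqVlt => /orP[/eqP ->|].
    by rewrite drop_cat sn ltnNge leqnSn/= subSnn /= drop0.
  by rewrite ltnS; exact: hs.
case: (lastP s) sn hs => // s' a; rewrite size_rcons => -[sn] hs; split.
  have := hs n.+1 (leqnn _).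
  by rewrite cat_rcons drop_cat sn ltnNge leqnSn/= subSnn /= drop0.
exists a; apply/(IH (a :: w)); exists s' => // k kn.
by have := hs k (leqW kn); rewrite cat_rcons.
Qed.

Lemma generation_alive h n x y (p : pred 'I_d.+1) :
  (exists i w, generation h (gff x y) n.+1 (Some (i, w)) /\ p i) <->
  h <= x /\ exists2 i, p i & alive h n i [::] x y.
Proof.
split=> [[i [w [[/clusterP hw /= [wn]] pi]]]|[hx [i pi]]].
  split; first by apply: (hw origin); apply/mem_geodesic; left.
  exists i => //; apply/(alive_path h n i [::] x y); exists w => // k kn.
  rewrite cats0; apply: (hw (Some (i, drop k w))).
  by apply/mem_geodesic; right; exists k; rewrite ?wn.
move=> /(alive_path h n i [::] x y)[w wn hw]; exists i, w; split=> //; split.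
  apply/clusterP => u /mem_geodesic[->//|[k kn ->]] /=.
  by have := hw k; rewrite cats0 -wn; apply.
by rewrite /= wn.
Qed.

Lemma forward_treeE i0 i w :
  forward_tree (Some (i0, [::])) (Some (i, w)) <-> i != i0.
Proof.
rewrite /forward_tree /=; split=> [/negP hn|/eqP ii].
  apply/eqP => ii; apply: hn; apply/mem_geodesic; right; exists (size w) => //.
  by rewrite drop_size ii.
by apply/negP => /mem_geodesic[//|[k _ [] /esym]].
Qed.

Lemma adj_origin (v : vertex d) : adj origin v -> exists i, v = Some (i, [::]).
Proof. by case: v => [[i [|a w]]|] //= _; exists i. Qed.

Lemma generation_nonempty h n x y :
  generation h (gff x y) n.+1 !=set0 <->
  h <= x /\ exists2 i, predT i & alive h n i [::] x y.
Proof.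
split=> [[v gv]|/(generation_alive h n x y)[i [w [gv _]]]].
  apply/(generation_alive h n x y); case: v gv => [[i w]|[_ //]] gv.
  by exists i, w.
by exists (Some (i, w)).
Qed.

Lemma forward_generation_nonempty h n x y i0 :
  generation h (gff x y) n.+1 `&` forward_tree (Some (i0, [::])) !=set0 <->
  h <= x /\ exists2 i, i != i0 & alive h n i [::] x y.
Proof.
split=> [[v [gv fv]]|].
  apply/(generation_alive h n x y (fun i => i != i0)).
  case: v gv fv => [[i w]|[_ //]] gv /forward_treeE fv.
  by exists i, w.
move=> /(generation_alive h n x y (fun i => i != i0))[i [w [gv pi]]].
by exists (Some (i, w)); split=> //; exact/forward_treeE.
Qed.

End clusters.

(** * Survival probabilities on the tree *)

Section law.
Context {dsp : measure_display} {Omega : measurableType dsp} {R : realType}.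

(** [distribution P X] and [normal_prob m s] live on two copies of the Borel
    sigma-algebra of [R] with different displays, hence the detour through the
    image by the identity. *)
Lemma integral_law (P : probability Omega R) (X : {RV P >-> R}) (m s : R)
    (f : R -> \bar R) :
  (forall A : set R, measurable A -> distribution P X A = normal_prob m s A) ->
  measurable_fun setT f -> (forall x, 0 <= f x)%E ->
  (\int[distribution P X]_x f x = \int[normal_prob m s]_x f x)%E.
Proof.
move=> law mf f0.
pose i (x : measurableTypeR R) : R := x.
have mi : measurable_fun setT i by move=> _ A mA; rewrite setTI; exact: mA.
transitivity (\int[pushforward (normal_prob m s) i]_x f x)%E.
  apply: (@eq_measure_integral _ _ _ _
    (measure_function_pushforward__canonical__measure_function_Measure
      (normal_prob m s) mi)) => A mA _.
  exact: law.
by have := ge0_integral_pushforward mi (normal_prob m s) measurableT mf (fun x _ => f0 x).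
Qed.

End law.

Section tree_probability.
Context {R : realType} {d : nat} {dsp : measure_display} {Omega : measurableType dsp}.
Variables (P : probability Omega R) (Y : vertex d -> {RV P >-> R}) (h : R).
Hypothesis hd : (2 <= d)%N.
Hypothesis hY : gff_innovations Y.
Notation D := (d%:R : R).
Local Notation info S := (g_sigma_algebraType (cylinder Y S)).
Local Notation field w := (fun v => Y v w).

Let Yind := innov_independent hY.

Definition descendants (i : 'I_d.+1) (w : seq 'I_d) : set (vertex d) :=
  [set v | exists s, v = Some (i, s ++ w)].

Let descendants_cons i a w : descendants i (a :: w) `<=` descendants i w.
Proof. by move=> _ [s ->]; exists (rcons s a); rewrite cat_rcons. Qed.

Let descendants_self i w : descendants i w (Some (i, w)).
Proof. by exists [::]. Qed.

Let descendants_child i a w v : descendants i (a :: w) v -> v != Some (i, w).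
Proof.
move=> [s ->]; apply/eqP => -[] /(congr1 size)/eqP.
by rewrite size_cat/= -[X in _ == X]add0n addnS -addSn eqn_add2r.
Qed.

Let descendants_disjoint i w a b : a != b ->
  [disjoint descendants i (a :: w) & descendants i (b :: w)].
Proof.
move=> ab; apply/disj_setPS => v [[s ->] [t []]].
move=> /(congr1 (fun l => nth a (rev l) (size w))).
rewrite !rev_cat !rev_cons !nth_cat !size_rcons size_rev ltnSn.
by rewrite !nth_rcons size_rev ltnn eqxx => /eqP; rewrite (negbTE ab).
Qed.

Let branches_disjoint i j : i != j ->
  [disjoint descendants i [::] & descendants j [::]].
Proof.
by move=> ij; apply/disj_setPS => v [[s ->] [t [/eqP]]]; rewrite (negbTE ij).
Qed.

Let measurable_Y S v : S v ->
  measurable_fun [set: info S] (Y v : info S -> R).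
Proof.
move=> Sv _ B mB; rewrite setTI; exact: info_Y.
Qed.

Let forget (S : set (vertex d)) (w : Omega) : info S := w.

Let measurable_forget S : measurable_fun setT (forget S).
Proof. by move=> _ B mB; rewrite setTI; exact: (info_measurable mB). Qed.

Lemma measurable_alive S n i w : descendants i w `<=` S ->
  measurable [set z : R * info S | alive h n i w z.1 (field z.2)].
Proof.
elim: n w => [|n IH] w wS.
all: have Sv : S (Some (i, w)) by exact/wS/descendants_self.
all: pose val (z : R * info S) : R := D^-1 * z.1 + Y (Some (i, w)) z.2.
all: have mval : measurable_fun setT val by
  apply: measurable_funD; [apply: measurable_funM => //; exact: measurable_fst|
    apply: (measurableT_comp (measurable_Y Sv)); exact: measurable_snd].
all: have mh : measurable [set z | h <= val z] by
  rewrite (_ : [set z | _] = val @^-1` `[h, +oo[%classic);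
   [rewrite -[X in measurable X]setTI; exact: mval
   |apply/seteqP; split=> z /=; rewrite in_itv/= andbT].
  rewrite (_ : [set z | _] = [set z | h <= val z])//.
  by apply/seteqP; split=> z /=; [case|].
rewrite (_ : [set z | _] = [set z | h <= val z] `&`
  \bigcup_(a in [set: 'I_d])
    ((fun z => (val z, z.2)) @^-1`
      [set z : R * info S | alive h n i (a :: w) z.1 (field z.2)])); last first.
  apply/seteqP; split=> z /=; first by move=> [hz [a ha]]; split=> //; exists a.
  by move=> [hz [a _ ha]]; split=> //; exists a.
apply: measurableI => //; apply: fin_bigcup_measurable; first exact: finite_finset.
move=> a _; rewrite -[X in measurable X]setTI.
have mp : measurable_fun setT (fun z : R * info S => (val z, z.2)).
  by apply: measurable_fun_pair => //; exact: measurable_snd.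
apply: mp => //; apply: IH => v; move=> /descendants_cons; exact: wS.
Qed.

Lemma info_alive n i w x :
  <<s cylinder Y (descendants i w) >> [set o | alive h n i w x (field o)].
Proof.
have := measurable_xsection x (@measurable_alive (descendants i w) n i w (fun v => id)).
rewrite (_ : xsection _ _ = [set o | alive h n i w x (field o)])//.
by apply/seteqP; split=> o; rewrite /xsection/= inE.
Qed.

HB.instance Definition _ S := isMeasurableFun.Build _ _ _ _ (forget S) (@measurable_forget S).

(** The innovation of a vertex is independent of all the others, so it may be
    integrated last. *)
Lemma freezing_vertex v (F : set (R * info [set u | u != v])) :
  measurable F ->
  P [set o | F (Y v o, o)] =
  (\int[distribution P (Y v)]_x P [set o | F (x, o)])%E.
Proof.
move=> mF.
apply: (@freezing _ _ _ _ _ P (Y v) (forget [set u | u != v])) => // A B mA mB.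
apply: (@info_indep _ _ _ _ P Y Yind [set v] [set u | u != v]) => //.
- by apply/disj_setPS => u /= [->]; rewrite eqxx.
- exact: info_Y.
Qed.

(** Complementation turns the union into an intersection of independent events. *)
Lemma exists_prob (I : finType) (p : pred I) (S : I -> set (vertex d))
    (A : I -> set Omega) (r : R) :
  (forall i j, i != j -> [disjoint S i & S j]) ->
  (forall i, <<s cylinder Y (S i) >> (A i)) -> (forall i, P (A i) = r%:E) ->
  P [set o | exists2 i, p i & A i o] = (1 - (1 - r) ^+ #|p|)%:E.
Proof.
move=> dS sA Ar.
have mA i : measurable (A i) by exact: info_measurable (sA i).
have -> : [set o | exists2 i, p i & A i o] =
    ~` (\big[setI/setT]_(i <- enum p) ~` A i).
  rewrite -bigcap_seq setC_bigcap; apply/seteqP; split=> o /=.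
    by move=> [i pi Ai]; exists i; rewrite /= ?mem_enum//; exact.
  by move=> [i /=]; rewrite mem_enum => pi /contrapT Ai; exists i.
rewrite probability_setC; last first.
  by apply: bigsetI_measurable => i _; exact: measurableC.
rewrite (info_indep_seq Yind (enum_uniq p) dS); last first.
  by move=> i; exact: (@measurableC _ (info (S i)) _ (sA i)).
under eq_bigr => i _ do rewrite probability_setC// Ar -EFinB.
rewrite [RHS]EFinB; congr (_ - _)%E.
by rewrite prodEFin big_enum prodr_const.
Qed.

Let q := survival d h.

(* The event that a vertex with value [z] is above level and survives [n]
   generations below itself. *)
Let lives n i w (z : R) (o : Omega) : Prop :=
  h <= z /\ if n is m.+1 then exists a, alive h m i (a :: w) z (field o) else True.

Let aliveE n i w x :
  [set o | alive h n i w x (field o)] =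
  [set o | lives n i w (D^-1 * x + Y (Some (i, w)) o) o].
Proof. by case: n. Qed.

Let measurable_ge S : measurable [set c : R * info S | h <= c.1].
Proof.
rewrite (_ : [set c | _] = fst @^-1` `[h, +oo[%classic); last first.
  by apply/seteqP; split=> c /=; rewrite in_itv/= andbT.
by rewrite -[X in measurable X]setTI; exact: measurable_fst.
Qed.

Let measurable_lives S n i w : (forall a, descendants i (a :: w) `<=` S) ->
  measurable [set c : R * info S | lives n i w c.1 c.2].
Proof.
move=> wS; case: n => [|n].
  rewrite (_ : [set c | _] = [set c | h <= c.1]); first exact: measurable_ge.
  by apply/seteqP; split=> c; [case|].
rewrite (_ : [set c | _] = [set c | h <= c.1] `&`
  \bigcup_(a in [set: 'I_d])
    [set c : R * info S | alive h n i (a :: w) c.1 (field c.2)]); last first.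
  apply/seteqP; split=> c /=; first by move=> [hz [a ha]]; split=> //; exists a.
  by move=> [hz [a _ ha]]; split=> //; exists a.
apply: measurableI; first exact: measurable_ge.
apply: fin_bigcup_measurable; first exact: finite_finset.
by move=> a _; exact: measurable_alive.
Qed.

Let lives_prob n i w z :
  (forall m a, n = m.+1 -> P [set o | alive h m i (a :: w) z (field o)] =
     (Lop d h (q m) z / D)%:E) ->
  P [set o | lives n i w z o] = (q n z)%:E.
Proof.
have [hz|hz] := leP h z; last first.
  move=> _; rewrite /q survival_out//.
  rewrite (_ : [set o | _] = set0) ?measure0//.
  by apply/seteqP; split=> o //= [+ _]; rewrite leNgt hz.
case: n => [_|n IH].
  rewrite /q survival0// (_ : [set o | _] = setT) ?probability_setT//.
  by apply/seteqP; split.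
rewrite /q survivalS//.
rewrite (_ : [set o | _] = [set o | exists2 a, xpredT a &
    alive h n i (a :: w) z (field o)]); last first.
  apply/seteqP; split=> o /=; first by move=> [_ [a ha]]; exists a.
  by move=> [a _ ha]; split=> //; exists a.
rewrite (@exists_prob 'I_d xpredT (fun a => descendants i (a :: w)) _
  (Lop d h (q n) z / D)).
- by rewrite card_ord.
- by move=> a b; exact: descendants_disjoint.
- by move=> a; exact: info_alive.
- by move=> a; exact: IH.
Qed.

(** Conditioning on the innovation of [(i, w)] gives the recursion of
    [survival]: the subtrees of the children are independent given the value at
    [(i, w)]. *)
Lemma alive_prob n i w x :
  P [set o | alive h n i w x (field o)] = (Lop d h (q n) x / D)%:E.
Proof.
elim/ltn_ind: n w x => n IH w x; rewrite aliveE.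
pose F : set (R * info [set u | u != Some (i, w)]) :=
  [set c | lives n i w (D^-1 * x + c.1) c.2].
have mF : measurable F.
  have mp : measurable_fun setT (fun c : R * info [set u | u != Some (i, w)] =>
      (D^-1 * x + c.1, c.2)).
    apply: measurable_fun_pair; last exact: measurable_snd.
    by apply: measurable_funD => //; exact: measurable_fst.
  have := mp measurableT _ (@measurable_lives [set u | u != Some (i, w)] n i w _).
  by rewrite setTI; apply => a v; exact: descendants_child.
rewrite -[LHS]/(P [set o | F (Y (Some (i, w)) o, o)]) (freezing_vertex mF).
rewrite -normal_Y_integral//; first last.
- by move=> y; exact: survival_out.
- by move=> y; exact: survival_ge0.
- exact: tame_survival.
have [mq _] := tame_survival h hd n.
rewrite -(@integral_law _ _ _ P (Y (Some (i, w))) 0 (sigma_Y R d)); first last.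
- by move=> y; rewrite lee_fin survival_ge0.
- apply/measurable_EFinP; apply: (measurableT_comp mq).
  exact: measurable_funD.
- by move=> A mA; exact: (innov_other hY).
apply: eq_integral => y _.
rewrite -[LHS]/(P [set o | lives n i w (D^-1 * x + y) o]) lives_prob//.
by move=> m a nm; apply: IH; rewrite nm.
Qed.

Lemma root_prob n x (p : pred 'I_d.+1) :
  P [set o | exists2 i, p i & alive h n i [::] x (field o)] =
  (1 - (1 - Lop d h (q n) x / D) ^+ #|p|)%:E.
Proof.
apply: (@exists_prob _ p (fun i => descendants i [::])).
- exact: branches_disjoint.
- by move=> i; exact: info_alive.
- by move=> i; exact: alive_prob.
Qed.

(** The innovation of the origin is its value and is independent of the rest; the
    values [x] are integrated under the stationary law. *)
Lemma origin_prob n (p : pred 'I_d.+1) (f : R -> R) : tame d h f ->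
  (forall x, 0 <= f x) -> (forall x, x < h -> f x = 0) ->
  (forall x, h <= x -> f x = 1 - (1 - Lop d h (q n) x / D) ^+ #|p|) ->
  P [set o | h <= Y origin o /\
      exists2 i, p i & alive h n i [::] (Y origin o) (field o)] =
  (nu_int d h f)%:E.
Proof.
move=> tf fge0 f0 fE; rewrite -normal_nu_integral//.
pose F : set (R * info [set u | u != origin]) :=
  [set c | h <= c.1 /\ exists2 i, p i & alive h n i [::] c.1 (field c.2)].
have mF : measurable F.
  rewrite (_ : F = [set c | h <= c.1] `&` \bigcup_(i in [set i | p i])
    [set c : R * info [set u | u != origin] |
      alive h n i [::] c.1 (field c.2)]); last first.
    apply/seteqP; split=> c /=; first by move=> [hz [i pi hi]]; split=> //; exists i.
    by move=> [hz [i pi hi]]; split=> //; exists i.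
  apply: measurableI; first exact: measurable_ge.
  apply: fin_bigcup_measurable; first exact: finite_finset.
  by move=> i _; apply: measurable_alive => v [s ->].
rewrite -[LHS]/(P [set o | F (Y origin o, o)]) (freezing_vertex mF).
rewrite -(@integral_law _ _ _ P (Y origin) 0 (sigma_nu R d)); first last.
- by move=> y; rewrite lee_fin.
- by apply/measurable_EFinP; case: tf.
- by move=> A mA; exact: (innov_origin hY).
apply: eq_integral => x _.
have [hx|hx] := leP h x.
  rewrite fE// -root_prob; congr (P _).
  by apply/seteqP; split=> o /=; [case|].
rewrite f0// (_ : [set o | _] = set0) ?measure0//.
by apply/seteqP; split=> o //= [+ _]; rewrite leNgt hx.
Qed.

End tree_probability.

(** * The theorem *)

Section inv_asymptotics_lemmas.
Context {R : realType}.

Lemma inv_asymptotics_of_cvg (a b : nat -> R) (c : R) : c != 0 ->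
  (forall n, a n.+1 = b n.+1) -> n%:R * b n @[n --> \oo] --> c ->
  inv_asymptotics a c.
Proof.
move=> c0 ab bc; exists (fun n => n%:R * b n / c - 1).
  have e0 : c / c - 1 = 0 by rewrite divff// subrr.
  rewrite -e0; apply: cvgB; last exact: cvg_cst.
  by apply: (cvgM bc); exact: cvg_cst.
case=> // n _; rewrite ab [1 + _]addrC subrK.
by field; rewrite c0 addrC natr1 pnatr_eq0.
Qed.

End inv_asymptotics_lemmas.

Section survival_probabilities.
Context {R : realType} {d : nat} {dsp : measure_display} {Omega : measurableType dsp}.
Variables (P : probability Omega R) (Y : vertex d -> {RV P >-> R}).
Hypothesis hd : (2 <= d)%N.
Hypothesis hY : gff_innovations Y.
Notation h := (h_star Y).

Lemma Px_survive_fwdE i0 x n : h <= x ->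
  Px_survive_fwd Y (Some (i0, [::])) x n.+1 = survival d h n.+1 x.
Proof.
move=> hx; rewrite /Px_survive_fwd.
rewrite (_ : [set w | _] = [set o | exists2 i, predC1 i0 i &
    alive h n i [::] x (fun v => Y v o)]).
  by rewrite root_prob// cardC1 card_ord survivalS.
apply/seteqP; split=> o /=.
  by move=> /forward_generation_nonempty[_ [i ii hi]]; exists i.
move=> [i ii hi]; apply/forward_generation_nonempty; split=> //.
by exists i.
Qed.

Lemma Px_surviveE x n : h <= x ->
  Px_survive Y x n.+1 = root_survival d h n.+1 x.
Proof.
move=> hx; rewrite /Px_survive.
rewrite (_ : [set w | _] = [set o | exists2 i, predT i &
    alive h n i [::] x (fun v => Y v o)]).
  by rewrite root_prob// card_ord /root_survival hx.
apply/seteqP; split=> o /=.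
  by move=> /generation_nonempty[_ [i ii hi]]; exists i.
by move=> [i ii hi]; apply/generation_nonempty; split=> //; exists i.
Qed.

Lemma P_survive_fwdE i0 n :
  P_survive_fwd Y (Some (i0, [::])) n.+1 = nu_int d h (survival d h n.+1).
Proof.
rewrite /P_survive_fwd.
rewrite (_ : [set w | _] = [set o | h <= Y origin o /\
    exists2 i, predC1 i0 i &
    alive h n i [::] (Y origin o) (fun v => Y v o)]).
  rewrite (@origin_prob _ _ _ _ _ _ _ hd hY n _ (survival d h n.+1))//.
  - exact: tame_survival.
  - by move=> x; exact: survival_ge0.
  - by move=> x; exact: survival_out.
  - by move=> x hx; rewrite survivalS// cardC1 card_ord.
apply/seteqP; split=> o /=.
  by move=> /forward_generation_nonempty[? [i ii hi]]; split=> //; exists i.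
move=> [? [i ii hi]]; apply/forward_generation_nonempty; split=> //.
by exists i.
Qed.

Lemma P_surviveE n : P_survive Y n.+1 = nu_int d h (root_survival d h n.+1).
Proof.
rewrite /P_survive.
rewrite (_ : [set w | _] = [set o | h <= Y origin o /\
    exists2 i, predT i &
    alive h n i [::] (Y origin o) (fun v => Y v o)]).
  rewrite (@origin_prob _ _ _ _ _ _ _ hd hY n _ (root_survival d h n.+1))//.
  - exact: tame_root_survival.
  - by move=> x; exact: root_survival_ge0.
  - by move=> x hx; rewrite /root_survival leNgt hx.
  - by move=> x hx; rewrite /root_survival hx card_ord.
apply/seteqP; split=> o /=.
  by move=> /generation_nonempty[? [i ii hi]]; split=> //; exists i.
by move=> [? [i ii hi]]; apply/generation_nonempty; split=> //; exists i.
Qed.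

End survival_probabilities.

Theorem theorem2p1 (R : realType) (d : nat) (hd : (2 <= d)%N)
    (obar : vertex d) (hobar : adj origin obar)
    (dsp : measure_display) (Omega : measurableType dsp)
    (P : probability Omega R) (Y : vertex d -> {RV P >-> R})
    (hY : gff_innovations Y)
    (chi : R -> R) (hchi : normalized_eigenfunction d (h_star Y) chi) :
  [/\ forall x : R, h_star Y <= x ->
        inv_asymptotics (Px_survive_fwd Y obar x) (C1 d chi * chi x),
      inv_asymptotics (P_survive_fwd Y obar)
        (C1 d chi * inner_nu d (fun=> 1) chi),
      forall x : R, h_star Y <= x ->
        inv_asymptotics (Px_survive Y x) (C1_tilde d chi * chi x)
    & inv_asymptotics (P_survive Y)
        (C1_tilde d chi * inner_nu d (fun=> 1) chi)].
Proof.
have [i0 ->] := adj_origin hobar.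
have d2 : 2 <= d%:R :> R := @d_ge2 R d hd.
have tchi := tame_chi hd hchi.
have s0 := chi_cube_gt0 hd hchi.
pose k := branch_quad d * chi_cube d (h_star Y) chi.
have b0 : 0 < branch_quad d :> R by rewrite divr_gt0//; lra.
have k0 : 0 < k by rewrite mulr_gt0.
have C1E : C1 d chi = k^-1.
  rewrite /C1 (inner_nuE (h := h_star Y))//; first last.
  - by move=> x hx; rewrite (chi_eq0 hchi) ?mulr0.
  - by move=> x; rewrite mulr_ge0 ?sqr_ge0// (chi_ge0 hchi).
  - by under eq_fun do rewrite -exprSr; exact: tame_chi_cube hd hchi.
  rewrite (eq_nu_int _ (g := fun x => chi x ^+ 3)); last first.
    by move=> x _; rewrite -exprSr.
  by rewrite /k invfM /branch_quad invf_div.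
have i1E : inner_nu d (fun=> 1) chi = nu_int d (h_star Y) chi.
  have e1 : (fun x => (fun=> 1) x * chi x) = chi by apply/funext => x; rewrite mul1r.
  rewrite (inner_nuE (h := h_star Y))//; first by rewrite e1.
  - by rewrite e1.
  - by move=> x; rewrite mul1r (chi_ge0 hchi).
  - by move=> x hx; rewrite mul1r (chi_eq0 hchi).
have i10 : 0 < nu_int d (h_star Y) chi.
  by apply: nu_int_gt0 => // x hx; exact: (chi_gt0 hchi).
have dd : 0 < (d%:R + 1) / d%:R :> R by rewrite divr_gt0//; lra.
have tE c : C1_tilde d chi * c = (d%:R + 1) / d%:R * c / k.
  by rewrite /C1_tilde C1E; ring.
rewrite i1E; split.
- move=> x hx; rewrite C1E mulrC; have X0 := chi_gt0 hchi hx.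
  apply: (inv_asymptotics_of_cvg _ _ (survival_cvg hd hchi hx)).
    by rewrite gt_eqF// divr_gt0.
  by move=> n; exact: Px_survive_fwdE.
- rewrite C1E mulrC; apply: (inv_asymptotics_of_cvg _ _ (nu_survival_cvg hd hchi)).
    by rewrite gt_eqF// divr_gt0.
  by move=> n; exact: P_survive_fwdE.
- move=> x hx; rewrite tE; have X0 := chi_gt0 hchi hx.
  apply: (inv_asymptotics_of_cvg _ _ (root_survival_cvg hd hchi hx)).
    by rewrite gt_eqF// divr_gt0// mulr_gt0.
  by move=> n; exact: Px_surviveE.
- rewrite tE; apply: (inv_asymptotics_of_cvg _ _ (nu_root_survival_cvg hd hchi)).
    by rewrite gt_eqF// divr_gt0// mulr_gt0.
  by move=> n; exact: P_surviveE.
Qed.
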